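(* Let $M$ be a smooth manifold with a volume form $\omega$, let $P$ be a Poisson bivector on $M$, let $\Xi$ be the $\omega$-modular vector field of $P$, and let $\nu\in C^\infty(M)$ be such that $\Xi(\nu)=1$. Then: (1) $\Xi\wedge P_\nu$ is a Poisson structure compatible with $P$; (2) $L_{\Xi\wedge P_\nu}(\omega)=-L_P(\omega)$; (3) $P+\Xi\wedge P_\nu$ is an $\omega$-unimodular Poisson structure compatible with $P$, and $\nu$ is a Casimir function of $P+\Xi\wedge P_\nu$; (4) $P_\nu\wedge\Xi=[\![P,\nu\Xi]\!]=\partial_P(\nu\Xi)$.
   Context: $[\![\cdot,\cdot]\!]$ is the Schouten bracket of multivector fields, in the convention fixed by $i_{[\![P,Q]\!]}=[[i_P,d]^{gr},i_Q]^{gr}$, where $[\cdot,\cdot]^{gr}$ is the graded commutator of operators on differential forms, $i_Q:\rho\mapsto Q\rfloor\rho$ is insertion, and $i_{P\wedge Q}=i_P\circ i_Q$. The Lie derivative along a multivector $Q$ is $L_Q=[i_Q,d]^{gr}$; in particular $L_Q(\omega)=-d(Q\rfloor\omega)$ for a bivector $Q$ and a top-degree form $\omega$. A bivector $P$ is Poisson if $[\![P,P]\!]=0$; the bracket is $\{f,g\}=P(df,dg)$. Two Poisson bivectors are compatible if their sum is a Poisson bivector. $\partial_P(Q)=[\![P,Q]\!]$. For $f\in C^\infty(M)$ the Hamiltonian field is $P_f=[\![P,f]\!]=-P(df,\cdot)$. The $\omega$-modular vector field $\Xi$ of $P$ is defined by $\Xi\rfloor\omega=d(P\rfloor\omega)$.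 $P$ is $\omega$-unimodular if $L_P(\omega)=0$. A Casimir function of a Poisson bivector $Q$ is a function $f$ with $Q(df,\cdot)=0$. *)

(* Defs.v *)
From HB Require Import structures.
From mathcomp Require Import all_boot all_order all_algebra.
From mathcomp Require Import all_classical all_reals all_analysis.

Set Implicit Arguments.
Unset Strict Implicit.
Unset Printing Implicit Defensive.

Import Order.TTheory GRing.Theory Num.Theory.
Import numFieldNormedType.Exports.

Local Open Scope classical_set_scope.
Local Open Scope ring_scope.

(** * Smooth maps and smooth manifolds *)

(* Only used for an open set [U], where being C^{k+1} means being Frechet
   differentiable with all directional derivatives of class C^k. *)
Fixpoint class_C {R : realType} {V W : normedModType R} (k : nat)
    (U : set V) (f : V -> W) : Prop :=
  match k with
  | 0 => forall x, U x -> {for x, continuous f}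
  | k'.+1 => (forall x, U x -> differentiable f x) /\
             forall v : V, class_C k' U (fun x => 'D_v f x)
  end.

Definition smooth_on {R : realType} {V W : normedModType R}
  (U : set V) (f : V -> W) : Prop := forall k, class_C k U f.

(* An [n]-dimensional manifold without boundary, given by an arbitrary (not
   necessarily maximal) smooth atlas. The chart [i] is the homeomorphism
   [coord i] from the open set [dom i] onto an open subset of R^n, with inverse
   [param i]; both are total functions with arbitrary values elsewhere. *)
Record manifold (R : realType) (n : nat) := Manifold {
  carrier :> topologicalType;
  chart : Type;
  dom : chart -> set carrier;
  coord : chart -> carrier -> 'rV[R]_n;
  param : chart -> 'rV[R]_n -> carrier;
  carrier_hausdorff : hausdorff_space carrier;
  carrier_second_countable : @second_countable carrier;
  dom_cover : forall p : carrier, exists i, dom i p;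
  dom_open : forall i, open (dom i);
  coord_open : forall i, open (coord i @` dom i);
  coordK : forall i p, dom i p -> param i (coord i p) = p;
  coord_continuous : forall i, {within dom i, continuous (coord i)};
  param_continuous : forall i,
    {within coord i @` dom i, continuous (param i)};
  transition_smooth : forall i j,
    smooth_on (coord i @` (dom i `&` dom j)) (coord j \o param i)
}.

Section Tensors.
Context {R : realType} {n : nat} (M : manifold R n).

Definition codom_chart (i : chart M) : set 'rV[R]_n := coord i @` dom i.

Definition overlap (i j : chart M) : set 'rV[R]_n :=
  coord i @` (dom i `&` dom j).

Definition transition (i j : chart M) : 'rV[R]_n -> 'rV[R]_n :=
  coord j \o param i.

Definition smooth_function (f : M -> R) : Prop :=
  forall i, smooth_on (codom_chart i) (f \o param i).

(* Tensor fields are represented by their local expressions: [T i x] is the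
   tensor at the point with coordinates [x] in the chart [i]. It is evaluated on
   finite sequences of arguments, so that all degrees live in a single type;
   a tensor of degree [k] vanishes on the sequences of size other than [k].
   Tangent vectors are row vectors, covectors are column vectors, and the value
   of the covector [a] on the tangent vector [v] is the entry of [v *m a].
   The values [T i x] are meaningful only for [x] in [codom_chart i]. *)
Definition field (V : Type) : Type := chart M -> 'rV[R]_n -> seq V -> R.
Definition form_field := field 'rV[R]_n.
Definition multivector_field := field 'cV[R]_n.

Definition eq_field (V : Type) (S T : field V) : Prop :=
  forall i x, codom_chart i x -> forall s, S i x s = T i x s.

Definition zero_field {V : Type} : field V := fun i x s => 0.
Definition opp_field {V : Type} (T : field V) : field V :=
  fun i x s => - T i x s.
Definition add_field {V : Type} (S T : field V) : field V :=
  fun i x s => S i x s + T i x s.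
Definition mul_field {V : Type} (f : M -> R) (T : field V) : field V :=
  fun i x s => f (param i x) * T i x s.

Definition alternating_multilinear {V : lmodType R} (f : seq V -> R) : Prop :=
  (forall s t (a : R) u v,
     f (s ++ (a *: u + v) :: t) = a * f (s ++ u :: t) + f (s ++ v :: t)) /\
  (forall s t r u, f (s ++ u :: t ++ u :: r) = 0).

Definition smooth_alternating (k : nat) (V : lmodType R) (T : field V) : Prop :=
  [/\ forall i x s, codom_chart i x -> size s != k -> T i x s = 0,
      forall i x, codom_chart i x -> alternating_multilinear (T i x) &
      forall i s, smooth_on (codom_chart i) (fun x => T i x s)].

Definition is_form (k : nat) (rho : form_field) : Prop :=
  smooth_alternating k rho /\
  forall i j x s, overlap i j x ->
    rho i x s =
    rho j (transition i j x) [seq 'd (transition i j) x v | v <- s].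

(* The pullback of the covector [a] by the differential of the transition map
   is ['J (transition i j) x *m a], as ['d f x v = v *m 'J f x]. *)
Definition is_multivector (k : nat) (Q : multivector_field) : Prop :=
  smooth_alternating k Q /\
  forall i j x s, overlap i j x ->
    Q j (transition i j x) s =
    Q i x [seq 'J (transition i j) x *m a | a <- s].

Definition is_volume_form (omega : form_field) : Prop :=
  is_form n omega /\
  forall i x, codom_chart i x -> exists s, omega i x s != 0.

(** * Operators on differential forms *)

(* d rho (v_0, .., v_k) = sum_l (-1)^l D_{v_l} rho (v_0, .., v_l omitted, ..),
   the vectors v_l being constant in the chart. *)
Definition ext_d (rho : form_field) : form_field := fun i x s =>
  \sum_(l < size s) (-1) ^+ l *
    'D_(s`_l) (fun y => rho i y (take l s ++ drop l.+1 s)) x.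

(* The sum runs over the index sets i_1 < .. < i_k (the degree [k] of [Q]
   selects the sets of cardinal [k]). As i_v rho = rho (v, ...), the convention
   i_{P /\ Q} = i_P o i_Q gives
   i_{e_{i_1} /\ .. /\ e_{i_k}} rho = rho (e_{i_k}, .., e_{i_1}, ...). *)
Definition insertion (Q : multivector_field) (rho : form_field) : form_field :=
  fun i x s =>
  \sum_(I : {set 'I_n})
    Q i x [seq delta_mx j 0 | j <- enum I] *
    rho i x (rev [seq delta_mx 0 j | j <- enum I] ++ s).

(* The graded commutator A B - (-1)^(|A||B|) B A, where [a] and [b] are natural
   numbers with the parities of the degrees of [A] and [B]. *)
Definition gcomm (a b : nat) (A B : form_field -> form_field) :
    form_field -> form_field :=
  fun rho i x s => A (B rho) i x s - (-1) ^+ (a * b) * B (A rho) i x s.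

Definition Lie (q : nat) (Q : multivector_field) : form_field -> form_field :=
  gcomm q 1 (insertion Q) ext_d.

(** * The Schouten bracket and Poisson bivectors *)

(* [is_schouten p q P Q T] says that T = [[P, Q]] for P and Q of degrees p, q;
   a multivector field is determined by its insertion operator. The operators
   i_P, d, [i_P, d] and i_Q have degrees - p, 1, 1 - p and - q. *)
Definition is_schouten (p q : nat) (P Q T : multivector_field) : Prop :=
  is_multivector (p + q).-1 T /\
  forall k rho, is_form k rho ->
    eq_field (insertion T rho)
      (gcomm p.+1 q (gcomm p 1 (insertion P) ext_d) (insertion Q) rho).

Definition is_poisson (P : multivector_field) : Prop :=
  is_multivector 2 P /\ is_schouten 2 2 P P zero_field.

Definition compatible (P Q : multivector_field) : Prop :=
  [/\ is_poisson P, is_poisson Q & is_poisson (add_field P Q)].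

(* [is_partial P q Q T] says that T = partial_P (Q) for Q of degree q. *)
Definition is_partial (P : multivector_field) (q : nat)
    (Q T : multivector_field) : Prop :=
  is_schouten 2 q P Q T.

Definition differential (f : M -> R) (i : chart M) (x : 'rV[R]_n) : 'cV[R]_n :=
  \col_j 'D_(delta_mx 0 j) (f \o param i) x.

Definition apply_vector (X : multivector_field) (f : M -> R)
    (i : chart M) (x : 'rV[R]_n) : R :=
  X i x [:: differential f i x].

(* P_f = - P (df, .) *)
Definition hamiltonian (P : multivector_field) (f : M -> R) :
    multivector_field := fun i x s =>
  if s is [:: a] then - P i x [:: differential f i x; a] else 0.

Definition wedge (X Y : multivector_field) : multivector_field := fun i x s =>
  if s is [:: a; b]
  then X i x [:: a] * Y i x [:: b] - X i x [:: b] * Y i x [:: a] else 0.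

Definition is_modular (omega : form_field) (P Xi : multivector_field) : Prop :=
  is_multivector 1 Xi /\
  eq_field (insertion Xi omega) (ext_d (insertion P omega)).

Definition unimodular (omega : form_field) (P : multivector_field) : Prop :=
  eq_field (Lie 2 P omega) zero_field.

Definition is_casimir (Q : multivector_field) (f : M -> R) : Prop :=
  smooth_function f /\
  forall i x, codom_chart i x ->
    forall a, Q i x [:: differential f i x; a] = 0.

End Tensors.

(* Main.v *)
Require Import Defs.
From HB Require Import structures.
From mathcomp Require Import all_boot all_order all_algebra.
From mathcomp Require Import all_classical all_reals all_analysis.
From mathcomp Require Import ring lra.

Import Order.TTheory GRing.Theory Num.Theory.
Import numFieldNormedType.Exports.

Local Open Scope classical_set_scope.
Local Open Scope ring_scope.

Set Implicit Arguments.
Unset Strict Implicit.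
Unset Printing Implicit Defensive.

(** The signs of the bracket and of the Lie derivative come from graded
    commutators of operators on differential forms, so the whole statement is an
    identity between such operators. It can be checked in one chart, on the
    space [form] of differential forms on an open subset of R^n: all the
    operators i_P, i_X, d and the multiplication by nu act linearly there.

    Write L_P = [i_P, d], X for the modular field and Y = P_nu. The statement
    follows by algebra from five facts: d d = 0; insertions of vector fields
    anticommute; [L_P, i_P] = 0 (P is Poisson); [L_P, i_X] = 0 (X preserves P);
    and i_Y = [L_P, nu], [L_X, nu] = X(nu) = 1. Indeed L_P L_P = 0 by the first
    and third facts; L_X commutes with L_P, so [L_X, i_Y] = [L_P, [L_X, nu]] =
    [L_P, 1] = 0, that is, X and Y commute, and the bracket of X /\ Y with
    itself vanishes; L_P anticommutes with i_X and with i_Y, so the bracket of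
    P with X /\ Y vanishes; [L_P, nu i_X] = [L_P, nu] i_X = i_Y i_X. As the
    bracket is bilinear and symmetric on bivectors, all combinations
    a P + X /\ Y with a constant are Poisson ([liec_insc]). For the volume
    form w one has L_P w = - i_X w, L_X w = 0 and L_Y w = w, which gives the Lie
    derivative of w along X /\ Y ([lieq_w]).

    The fact [L_P, i_X] = 0 is where the volume form enters. On w it reads
    - L_P L_P w - i_X i_X w = 0, which holds. To pass from w to all forms,
    [L_P, i_X] is shown to be a zero-order operator, the insertion of a bivector
    ([contraction_lieb_insv]), and an insertion that kills a volume form is zero
    ([contraction_eq0]). The same argument ([contraction_lieb_insb]) extends
    [L_P, i_P] = 0 from w, which is the local expression of a form on the
    manifold, to all the forms on the chart, which need not extend to the
    manifold.

    The identities involving d are proved by induction on the number of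
    arguments from Cartan's formula i_v d + d i_v = D_v for a constant vector v
    ([iota_extd], [form_ind_eq0]); d d = 0 rests on the symmetry of second
    derivatives ([derive_comm]). Finally P_nu, X /\ P_nu and P + X /\ P_nu are
    multivector fields on the manifold by the chain rule
    ([differential_transition]). *)

(** * Smooth functions on an open set *)

Lemma near_eq_differentiable {R : realType} {V W : normedModType R}
    (f g : V -> W) (x : V) :
  (\near x, f x = g x) -> differentiable f x -> differentiable g x.
Proof.
move=> fg df.
have fgx : f x = g x by exact: nbhs_singleton fg.
have gE : g \o shift x = cst (g x) + 'd f x +o_ 0 id.
  have [_ /eqaddoP dfo] := (diff_locallyP _ _).1 df.
  apply/eqaddoP => e e0; have := dfo e e0.
  have fg0 : \forall y \near 0, f (y + x) = g (y + x).
    have /= := (near_shift 0 x (fun y => f y = g y)).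
    by rewrite subr0 => <-.
  apply: filterS2 fg0 => y /= fgy.
  by rewrite !fctE /= fgy fgx.
have dgE := diff_unique (diff_continuous df) gE.
apply/diff_locallyP; split; last by rewrite dgE.
by rewrite dgE; exact: diff_continuous.
Qed.

Section Smooth.
Context {R : realType} {V : normedModType R}.
Implicit Types (U : set V) (f g : V -> R).

Lemma smooth_onE U f : smooth_on U f <->
  (forall x, U x -> differentiable f x) /\
  forall v, smooth_on U (fun x => 'D_v f x).
Proof.
split=> [fU|[df dfU] [|k]]; last by split=> // v; exact: dfU.
  by split=> [|v k]; [exact: (fU 1%N).1 | exact: (fU k.+1).2].
by move=> x Ux; exact/differentiable_continuous/df.
Qed.

Lemma smooth_differentiable U f x :
  smooth_on U f -> U x -> differentiable f x.
Proof. by move=> /smooth_onE[+ _]; apply. Qed.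

Lemma smooth_derive U f v : smooth_on U f -> smooth_on U (fun x => 'D_v f x).
Proof. by move=> /smooth_onE[_]. Qed.

Lemma smooth_derivable U f x v : smooth_on U f -> U x -> derivable f x v.
Proof. by move=> fU Ux; exact/diff_derivable/(smooth_differentiable fU). Qed.

Lemma smooth_continuous U f x : smooth_on U f -> U x -> {for x, continuous f}.
Proof. by move=> fU; exact: (fU 0%N). Qed.

Lemma smooth_cst U (c : R) : smooth_on U (fun=> c).
Proof.
move=> k; elim: k c => [|k IH] c; first by move=> x _; exact: cst_continuous.
split=> [x _|v]; first exact: differentiable_cst.
by have -> : (fun x : V => 'D_v (fun=> c) x) = (fun=> 0);
  [apply/funext => x; rewrite derive_cst|exact: IH].
Qed.

Section Open.
Variables (U : set V).
Hypothesis openU : open U.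

Lemma eq_on_near f g x : {in U, f =1 g} -> U x -> \forall y \near x, f y = g y.
Proof.
move=> fg Ux; have := open_nbhs_nbhs (conj openU Ux).
by apply: filterS => y Uy; apply: fg; rewrite inE.
Qed.

Lemma eq_on_derive f g v : {in U, f =1 g} ->
  {in U, (fun x => 'D_v f x) =1 (fun x => 'D_v g x)}.
Proof.
by move=> fg x; rewrite inE => Ux; exact/near_eq_derive/(eq_on_near fg).
Qed.

(** Leibniz' rule takes a product to a sum of products, so no class of the form
    [class_C k] alone supports an induction on products. The closure of the
    smooth functions under sums, products and equality on [U] is stable under
    directional derivatives, and therefore consists of smooth functions. *)
Inductive smooth_closure : (V -> R) -> Prop :=
| Closure_smooth f : smooth_on U f -> smooth_closure f
| Closure_add f g : smooth_closure f -> smooth_closure g ->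
    smooth_closure (fun x => f x + g x)
| Closure_mul f g : smooth_closure f -> smooth_closure g ->
    smooth_closure (fun x => f x * g x)
| Closure_eq f g : {in U, f =1 g} -> smooth_closure f -> smooth_closure g.

Lemma smooth_closure_derive f : smooth_closure f ->
  (forall x, U x -> differentiable f x) /\
  forall v, smooth_closure (fun x => 'D_v f x).
Proof.
elim=> {f} [f /smooth_onE[df Df]|f g _ [df Df] _ [dg Dg]
           |f g cf [df Df] cg [dg Dg]|f g fg _ [df Df]].
- by split=> // v; exact: Closure_smooth.
- split=> [x Ux|v]; first exact: differentiableD (df x Ux) (dg x Ux).
  apply: Closure_eq (Closure_add (Df v) (Dg v)) => x; rewrite inE => Ux.
  by rewrite -deriveD//; apply/diff_derivable; [exact: df|exact: dg].
- split=> [x Ux|v]; first exact: differentiableM (df x Ux) (dg x Ux).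
  have := Closure_add (Closure_mul cf (Dg v)) (Closure_mul cg (Df v)).
  apply: Closure_eq => x; rewrite inE => Ux; apply/esym.
  by apply: (@deriveM _ _ f g); apply/diff_derivable; [exact: df|exact: dg].
- split=> [x Ux|v].
    exact: near_eq_differentiable (eq_on_near fg Ux) (df _ Ux).
  exact: Closure_eq (eq_on_derive v fg) (Df v).
Qed.

Lemma smooth_closureP f : smooth_closure f -> smooth_on U f.
Proof.
move=> cf k; elim: k f cf => [|k IH] f /smooth_closure_derive[df Df].
  by move=> x Ux; exact/differentiable_continuous/df.
by split=> // v; exact: IH.
Qed.

Lemma eq_smooth f g : {in U, f =1 g} -> smooth_on U f -> smooth_on U g.
Proof.
by move=> fg sf; exact/smooth_closureP/(Closure_eq fg)/Closure_smooth.
Qed.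

Lemma smoothD f g :
  smooth_on U f -> smooth_on U g -> smooth_on U (fun x => f x + g x).
Proof.
by move=> sf sg; apply/smooth_closureP/Closure_add; exact: Closure_smooth.
Qed.

Lemma smoothM f g :
  smooth_on U f -> smooth_on U g -> smooth_on U (fun x => f x * g x).
Proof.
by move=> sf sg; apply/smooth_closureP/Closure_mul; exact: Closure_smooth.
Qed.

Lemma smooth_sum (I : Type) (r : seq I) (p : pred I) (F : I -> V -> R) :
  (forall i, smooth_on U (F i)) ->
  smooth_on U (fun x => \sum_(i <- r | p i) F i x).
Proof.
move=> sF; elim: r => [|i r IH].
  by under eq_fun do rewrite big_nil; exact: smooth_cst.
under eq_fun do rewrite big_cons.
by case: (p i) => //; exact: smoothD.
Qed.

Lemma is_derive_line f y u (t : R) : differentiable f (y + t *: u) ->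
  is_derive t 1 (fun t : R => f (y + t *: u)) ('D_u f (y + t *: u)).
Proof.
move=> df; pose l (t : R) := y + t *: u.
have dl : is_diff t l ( *:%R^~ u).
  by rewrite /l; apply: is_diff_eq; apply/funext => z; rewrite /= add0r.
have dfl : differentiable (f \o l) t by apply: differentiable_comp.
apply: DeriveDef; first exact: diff_derivable.
rewrite deriveE// -[fun _ => _]/(f \o l) diff_comp//= deriveE//.
by rewrite (diff_val (is_diff_def := dl)) scale1r.
Qed.

Lemma mvt_line f y u (h : R) : 0 < h ->
  (forall t : R, 0 <= t <= h -> differentiable f (y + t *: u)) ->
  exists2 t : R, 0 <= t <= h & f (y + h *: u) - f y = 'D_u f (y + t *: u) * h.
Proof.
move=> h0 df.
have [||t th E] := @MVT _ (fun t => f (y + t *: u))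
  (fun t => 'D_u f (y + t *: u)) 0 h h0.
- move=> t /[!in_itv]/= /andP[t0 th]; apply/is_derive_line/df.
  by rewrite !ltW.
- apply: derivable_within_continuous => t /[!in_itv]/= th.
  by have [] := is_derive_line (df t th).
exists t; first by move: th; rewrite in_itv/= => /andP[? ?]; rewrite !ltW.
by rewrite scale0r addr0 subr0 in E.
Qed.

(** The mean value theorem is applied to the difference
    y |-> f (y + h v) - f y along [u], then to 'D_u f along [v]. *)
Lemma second_difference f x u v (h : R) : smooth_on U f -> 0 < h ->
  (forall a b : R, 0 <= a <= h -> 0 <= b <= h -> U (x + a *: u + b *: v)) ->
  exists a b : R, [/\ 0 <= a <= h, 0 <= b <= h &
    f (x + h *: u + h *: v) - f (x + h *: u) - f (x + h *: v) + f x =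
    'D_v (fun y => 'D_u f y) (x + a *: u + b *: v) * h ^+ 2].
Proof.
move=> sf h0 Uab; have hh : 0 <= h <= h by rewrite ltW//=.
have h00 : (0 : R) <= 0 <= h by rewrite lexx ltW.
pose g y := f (y + h *: v) - f y.
have dfv y : U (y + h *: v) -> differentiable (fun y => f (y + h *: v)) y.
  move=> Uy.
  apply: (@differentiable_comp _ _ _ _ (fun y => y + h *: v) f) => //.
  exact: smooth_differentiable Uy.
have dg y : U y -> U (y + h *: v) -> differentiable g y.
  move=> Uy Uyv; apply: (@differentiableB _ _ _ (fun y => f (y + h *: v)) f).
    exact: dfv.
  exact: smooth_differentiable Uy.
have Uu (a : R) : 0 <= a <= h -> U (x + a *: u).
  by move=> ah; have := Uab a 0 ah h00; rewrite scale0r addr0.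
have [|a ah gE] := @mvt_line g x u h h0.
  by move=> t th; apply: dg; [exact: Uu|exact: Uab].
have [|b bh DE] := @mvt_line (fun y => 'D_u f y) (x + a *: u) v h h0.
  move=> t th; apply: smooth_differentiable (smooth_derive u sf) _.
  exact: Uab.
exists a, b; split=> //.
rewrite expr2 mulrA -DE -[RHS]/(('D_u f _ - 'D_u f _) * h).
have <- : 'D_u g (x + a *: u) =
    'D_u f (x + a *: u + h *: v) - 'D_u f (x + a *: u).
  rewrite (@deriveB _ _ _ (fun y => f (y + h *: v)) f); last 2 first.
  - exact/diff_derivable/dfv/Uab.
  - exact (smooth_derivable sf (Uu a ah)).
  rewrite /derive; congr (lim _ - _).
  suff -> : (fun y => f (y + h *: v)) \o shift (x + a *: u) =
      f \o shift (x + a *: u + h *: v) by [].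
  by apply/funext => k; rewrite /= -!addrA.
by rewrite -gE /g; ring.
Qed.

(** Both mixed derivatives at [x] are limits of the second difference of [f]
    divided by h^2: by [second_difference], in the directions [u] and [v] taken
    in either order, this quotient is the value of either mixed derivative at a
    point close to [x]. *)
Lemma derive_comm f x u v : smooth_on U f -> U x ->
  'D_v (fun y => 'D_u f y) x = 'D_u (fun y => 'D_v f y) x.
Proof.
move=> sf Ux; apply/eqP; rewrite -subr_eq0 -normr_eq0; apply/eqP/le_anti.
rewrite normr_ge0 andbT; apply/ler_addgt0Pr => e e0; rewrite add0r.
have cvu : {for x, continuous (fun y => 'D_v (fun y => 'D_u f y) y)}.
  exact: smooth_continuous (smooth_derive v (smooth_derive u sf)) Ux.
have cuv : {for x, continuous (fun y => 'D_u (fun y => 'D_v f y) y)}.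
  exact: smooth_continuous (smooth_derive u (smooth_derive v sf)) Ux.
have e2 : 0 < e / 2 by rewrite divr_gt0.
have /nbhs_ballP[d /= d0 dP] : \forall y \near x, [/\ U y,
    `|'D_v (fun y => 'D_u f y) x - 'D_v (fun y => 'D_u f y) y| < e / 2 &
    `|'D_u (fun y => 'D_v f y) x - 'D_u (fun y => 'D_v f y) y| < e / 2].
  have nU : \forall y \near x, U y by exact: open_nbhs_nbhs.
  have nvu := (@cvgrPdist_lt _ _ _ _ (nbhs_filter x) _ _).1 cvu _ e2.
  have nuv := (@cvgrPdist_lt _ _ _ _ (nbhs_filter x) _ _).1 cuv _ e2.
  exact: filterS3 (fun y Uy yvu yuv => And3 Uy yvu yuv) nU nvu nuv.
(* The parallelogram spanned by h u and h v at x stays at distance < d of x. *)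
pose m := `|u| + `|v| + 1.
have m0 : 0 < m by rewrite /m; have := normr_ge0 u; have := normr_ge0 v; lra.
pose h := d / (2 * m).
have h0 : 0 < h by rewrite divr_gt0 ?mulr_gt0.
have near_x (a b : R) : 0 <= a <= h -> 0 <= b <= h ->
    ball x d (x + a *: u + b *: v).
  move=> /andP[a0 ah] /andP[b0 bh]; rewrite -ball_normE /= -addrA opprD addNKr.
  rewrite normrN (le_lt_trans (ler_normD _ _))// !normrZ !ger0_norm//.
  apply: (@le_lt_trans _ _ (h * m)); last first.
    rewrite /h invfM mulrA -mulrA mulVf ?gt_eqF// mulr1; lra.
  rewrite /m !mulrDr mulr1; have : a * `|u| <= h * `|u| by rewrite ler_wpM2r.
  have : b * `|v| <= h * `|v| by rewrite ler_wpM2r.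
  by move: h0; lra.
have [a [b [ah bh E1]]] : exists a b : R, [/\ 0 <= a <= h, 0 <= b <= h &
    f (x + h *: u + h *: v) - f (x + h *: u) - f (x + h *: v) + f x =
    'D_v (fun y => 'D_u f y) (x + a *: u + b *: v) * h ^+ 2].
  by apply: second_difference => // a b ah bh; case: (dP _ (near_x _ _ ah bh)).
have [b' [a' [bh' ah' E2]]] : exists b a : R, [/\ 0 <= b <= h, 0 <= a <= h &
    f (x + h *: v + h *: u) - f (x + h *: v) - f (x + h *: u) + f x =
    'D_u (fun y => 'D_v f y) (x + b *: v + a *: u) * h ^+ 2].
  apply: second_difference => // b' a' bh' ah'.
  by rewrite addrAC; case: (dP _ (near_x _ _ ah' bh')).
have h20 : h ^+ 2 != 0 by rewrite expf_neq0// gt_eqF.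
have E : 'D_v (fun y => 'D_u f y) (x + a *: u + b *: v) =
         'D_u (fun y => 'D_v f y) (x + a' *: u + b' *: v).
  have -> : x + a' *: u + b' *: v = x + b' *: v + a' *: u by rewrite addrAC.
  apply: (mulIf h20); apply: (etrans (esym E1)); apply: (etrans _ E2).
  have -> : x + h *: v + h *: u = x + h *: u + h *: v by rewrite addrAC.
  by ring.
have [_ n1 _] := dP _ (near_x _ _ ah bh).
have [_ _ n2] := dP _ (near_x _ _ ah' bh').
rewrite -[_ - _](subrKA ('D_v (fun y => 'D_u f y) (x + a *: u + b *: v))).
rewrite [in X in _ + X]E (splitr e).
apply: (le_trans (ler_normD _ _)).
apply: lerD; first exact: (ltW n1).
rewrite distrC.
exact: (ltW n2).
Qed.

End Open.
End Smooth.

(** * Differential forms on an open subset of R^n *)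

Record open_set (R : realType) (n : nat) := OpenSet {
  open_carrier :> set 'rV[R]_n;
  open_carrierP : open open_carrier }.
Arguments open_carrier {R n} o _.
Arguments open_carrierP {R n} o.

Section AlternatingMultilinear.
Context {R : realType} {V : lmodType R} {f : seq V -> R}.
Hypothesis fP : alternating_multilinear f.

Lemma multilinear_add s t u v :
  f (s ++ (u + v) :: t) = f (s ++ u :: t) + f (s ++ v :: t).
Proof. by have [/(_ s t 1 u v)+ _] := fP; rewrite scale1r mul1r. Qed.

Lemma multilinear0 s t : f (s ++ 0 :: t) = 0.
Proof.
have := multilinear_add s t 0 0; rewrite addr0 => /eqP.
by rewrite -subr_eq subrr => /eqP.
Qed.

Lemma multilinearZ s t a u : f (s ++ a *: u :: t) = a * f (s ++ u :: t).
Proof. by have [/(_ s t a u 0)+ _] := fP; rewrite addr0 multilinear0 addr0. Qed.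

Lemma multilinear_sum (I : Type) (r : seq I) (F : I -> V) s t :
  f (s ++ (\sum_(i <- r) F i) :: t) = \sum_(i <- r) f (s ++ F i :: t).
Proof.
elim: r => [|i r IH]; first by rewrite !big_nil multilinear0.
by rewrite !big_cons multilinear_add IH.
Qed.

Lemma alternating_swap s t u v : f (s ++ u :: v :: t) = - f (s ++ v :: u :: t).
Proof.
apply/eqP; rewrite -addr_eq0; apply/eqP.
have [_ alt] := fP.
have := alt s [::] t (u + v); rewrite /= multilinear_add.
have E w : f (s ++ w :: u + v :: t) =
    f (s ++ w :: u :: t) + f (s ++ w :: v :: t).
  by rewrite -cat_rcons multilinear_add !cat_rcons.
by rewrite !E !(alt s [::] t) addr0 add0r.
Qed.

End AlternatingMultilinear.

Section Forms.
Context {R : realType} {n : nat} (O : open_set R n).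
Local Notation E := 'rV[R]_n.
Local Notation U := (open_carrier O).

Definition is_local_form (r : E -> seq E -> R) : Prop :=
  [/\ forall x, alternating_multilinear (r x),
      forall s, smooth_on U (fun x => r x s) &
      forall x s, ~ U x -> r x s = 0].

Definition local_form_pred : {pred (E -> seq E -> R)} :=
  [pred r | `[< is_local_form r >]].

Lemma local_form_submod : submod_closed local_form_pred.
Proof.
have oU := open_carrierP O.
split=> [|a r t /asboolP[rA rS r0] /asboolP[tA tS t0]]; apply/asboolP; split.
- by split=> *; rewrite /= ?mulr0 ?addr0.
- by move=> s; exact: smooth_cst.
- by [].
- move=> x; have [rl ra] := rA x; have [tl ta] := tA x.
  split=> [s1 s2 b u v|s1 s2 s3 u]; rewrite !fctE /=.
    by rewrite rl tl /GRing.scale/=; ring.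
  by rewrite ra ta scaler0 addr0.
- by move=> s; apply: smoothD => //; apply: smoothM => //; exact: smooth_cst.
- by move=> x s Ux; rewrite !fctE r0// t0// scaler0 addr0.
Qed.

HB.instance Definition _ :=
  GRing.isSubmodClosed.Build R (E -> seq E -> R) local_form_pred
    local_form_submod.

(** The forms on [U], of mixed degree; extending them by zero outside [U] turns
    equality on [U] into equality, so that the forms on [U] are a vector space
    on which [ext_d] and the insertions act as linear operators. *)
Record form := Form {
  form_val :> E -> seq E -> R;
  _ : form_val \in local_form_pred }.

HB.instance Definition _ := [isSub for form_val].
HB.instance Definition _ := [Choice of form by <:].
HB.instance Definition _ := [SubChoice_isSubLmodule of form by <:].

Implicit Types (r : form) (x u v : E) (s : seq E).

Lemma form_alternating r x : alternating_multilinear (r x).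
Proof. by case: r => r /= /asboolP[]. Qed.

Lemma form_smooth r s : smooth_on U (fun x => r x s).
Proof. by case: r => r /= /asboolP[]. Qed.

Lemma form_out r x s : ~ U x -> r x s = 0.
Proof. by case: r => r /= /asboolP[_ _ +]; apply. Qed.

Lemma formD r (t : form) x s : (r + t) x s = r x s + t x s. Proof. by []. Qed.
Lemma formN r x s : (- r) x s = - r x s. Proof. by []. Qed.
Lemma formZ a r x s : (a *: r) x s = a * r x s. Proof. by []. Qed.
Lemma form0 x s : (0 : form) x s = 0. Proof. by []. Qed.
Lemma form_sum (I : Type) (l : seq I) (p : pred I) (F : I -> form) x s :
  (\sum_(i <- l | p i) F i) x s = \sum_(i <- l | p i) F i x s.
Proof.
elim: l => [|i l IH]; first by rewrite !big_nil.
by rewrite !big_cons; case: (p i); rewrite ?formD ?IH.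
Qed.
Definition formE := (formD, formN, formZ, form0, form_sum).

Lemma form_eq r (t : form) : (forall x s, U x -> r x s = t x s) -> r = t.
Proof.
move=> rt; apply/val_inj/funext => x; apply/funext => s /=.
by have [/rt//|nUx] := pselect (U x); rewrite !form_out.
Qed.

Lemma form_opp_eq0 r : r = - r -> r = 0.
Proof.
move=> /eqP; rewrite -addr_eq0 -mulr2n -scaler_nat scaler_eq0 pnatr_eq0.
by move=> /eqP.
Qed.

Section Restriction.
Context {f : E -> seq E -> R}.
Hypothesis f_alt : forall x, U x -> alternating_multilinear (f x).
Hypothesis f_smooth : forall s, smooth_on U (fun x => f x s).

Lemma restriction_subproof :
  (fun x s => if `[< U x >] then f x s else 0) \in local_form_pred.
Proof.
apply/asboolP; split.
- move=> x; case: asboolP => [/f_alt//|_].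
  by split=> *; rewrite ?mulr0 ?addr0.
- move=> s; apply: eq_smooth (f_smooth s); first exact: open_carrierP.
  by move=> x; rewrite inE => Ux; case: asboolP.
- by move=> x s nUx; case: asboolP.
Qed.

Definition restriction : form := Form restriction_subproof.

Lemma restrictionE x s : U x -> restriction x s = f x s.
Proof. by move=> Ux; rewrite /=; case: asboolP. Qed.
End Restriction.

(** ** Insertion of a constant vector, and multiplication by a function *)

Lemma iota_subproof v r : (fun x s => r x (v :: s)) \in local_form_pred.
Proof.
apply/asboolP; split=> [x|s|x s nUx]; last exact: form_out.
  have [lin alt] := form_alternating r x.
  by split=> *; [exact: (lin (v :: _))|exact: (alt (v :: _))].
exact: form_smooth.
Qed.

Definition iota v r : form := Form (iota_subproof v r).

Lemma iotaE v r x s : iota v r x s = r x (v :: s). Proof. by []. Qed.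

Lemma iota_linear v : linear (iota v).
Proof. by move=> a r t; exact: val_inj. Qed.
HB.instance Definition _ v :=
  GRing.isLinear.Build R form form _ (iota v) (iota_linear v).

Lemma iotaC u v r : iota u (iota v r) = - iota v (iota u r).
Proof.
apply: form_eq => x s _; rewrite formN !iotaE.
exact: (alternating_swap (form_alternating r x) [::]).
Qed.

Lemma iotaP a u v r : iota (a *: u + v) r = a *: iota u r + iota v r.
Proof.
apply: form_eq => x s _; rewrite formD formZ !iotaE.
by have [/(_ [::])+ _] := form_alternating r x; apply.
Qed.

(** By induction on the number of arguments: K r (v :: s) is a multiple of
    K (iota v r) s. With [iota_extd], this proves the identities between
    operators involving [d] without expanding the sum that defines [d]. *)
Lemma form_ind_eq0 (K : form -> form) :
  (forall r x, U x -> K r x [::] = 0) ->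
  (forall v r, exists e : R, iota v (K r) = e *: K (iota v r)) ->
  forall r, K r = 0.
Proof.
move=> K0 Ki r; apply: form_eq => x s Ux; rewrite form0.
elim: s r => [|v s IH] r; first exact: K0.
by have [e] := Ki v r; rewrite -iotaE => ->; rewrite formZ IH mulr0.
Qed.

Record smooth_fun := SmoothFun {
  sfun :> E -> R;
  sfunP : smooth_on U sfun }.

Definition sfun_derive (f : smooth_fun) v : smooth_fun :=
  SmoothFun (smooth_derive v (sfunP f)).

Lemma mulf_subproof (f : smooth_fun) r :
  (fun x s => f x * r x s) \in local_form_pred.
Proof.
apply/asboolP; split=> [x|s|x s nUx]; last by rewrite form_out// mulr0.
  have [lin alt] := form_alternating r x.
  by split=> *; rewrite ?lin ?alt; ring.
by apply: smoothM; [exact: open_carrierP|exact: sfunP|exact: form_smooth].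
Qed.

Definition mulf (f : smooth_fun) r : form := Form (mulf_subproof f r).

Lemma mulfE f r x s : mulf f r x s = f x * r x s. Proof. by []. Qed.

Lemma mulf_linear f : linear (mulf f).
Proof.
by move=> a r t; apply: form_eq => x s _; rewrite !formE !mulfE !formE; ring.
Qed.
HB.instance Definition _ f :=
  GRing.isLinear.Build R form form _ (mulf f) (mulf_linear f).

Lemma mulfC f g r : mulf f (mulf g r) = mulf g (mulf f r).
Proof. by apply: form_eq => x s _; rewrite !mulfE mulrCA. Qed.

Lemma iota_mulf v f r : iota v (mulf f r) = mulf f (iota v r).
Proof. exact: val_inj. Qed.

(** ** Partial derivatives and the exterior derivative *)

Lemma form_derivable r s x v : U x -> derivable (fun y => r y s) x v.
Proof. by move=> Ux; exact: smooth_derivable (form_smooth r s) Ux. Qed.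

Lemma derive_formP v a r (t : form) x s : U x ->
  'D_v (fun y => (a *: r + t) y s) x =
  a * 'D_v (fun y => r y s) x + 'D_v (fun y => t y s) x.
Proof.
move=> Ux.
rewrite (@deriveD _ _ _ (fun y => a *: r y s) (fun y => t y s)); last 2 first.
- by apply: derivableZ; exact: form_derivable.
- exact: form_derivable.
by rewrite (@deriveZ _ _ _ (fun y => r y s))//; exact: form_derivable.
Qed.

Lemma partial_alternating v r x : U x ->
  alternating_multilinear (fun s => 'D_v (fun y => r y s) x).
Proof.
move=> Ux; split=> [s t a u w|s t q u].
- have -> : (fun y => r y (s ++ (a *: u + w) :: t)) =
    (fun y => a *: r y (s ++ u :: t) + r y (s ++ w :: t)).
    by apply/funext => y; have [-> _] := form_alternating r y.
  rewrite (@deriveD _ _ _ (fun y => a *: r y (s ++ u :: t))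
                          (fun y => r y (s ++ w :: t))); last 2 first.
  - by apply: derivableZ; exact: form_derivable.
  - exact: form_derivable.
  rewrite (@deriveZ _ _ _ (fun y => r y (s ++ u :: t)))//.
  exact: form_derivable.
- under eq_fun do rewrite (form_alternating r _).2.
  by rewrite derive_cst.
Qed.

Definition partial v r : form := restriction (partial_alternating v r)
  (fun s => smooth_derive v (form_smooth r s)).

Lemma partialE v r x s : U x -> partial v r x s = 'D_v (fun y => r y s) x.
Proof. exact: restrictionE. Qed.

Lemma partial_linear v : linear (partial v).
Proof.
move=> a r t; apply: form_eq => x s Ux; rewrite !formE !partialE//.
exact: derive_formP.
Qed.
HB.instance Definition _ v :=
  GRing.isLinear.Build R form form _ (partial v) (partial_linear v).

Lemma partial_iota u v r : partial u (iota v r) = iota v (partial u r).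
Proof. by apply: form_eq => x s Ux; rewrite iotaE !partialE. Qed.

Lemma partialC u v r : partial u (partial v r) = partial v (partial u r).
Proof.
have oU := open_carrierP O.
apply: form_eq => x s Ux; rewrite (partialE u _ _ Ux) (partialE v _ _ Ux).
have E w : {in U, (fun y => partial w r y s) =1
                   (fun y => 'D_w (fun z => r z s) y)}.
  by move=> y; rewrite inE => Uy; rewrite partialE.
have Ux' : x \in U by rewrite inE.
rewrite (eq_on_derive oU u (E v) Ux') (eq_on_derive oU v (E u) Ux').
exact: derive_comm (form_smooth r s) Ux.
Qed.

Lemma partial_mulf v f r :
  partial v (mulf f r) = mulf (sfun_derive f v) r + mulf f (partial v r).
Proof.
apply: form_eq => x s Ux; rewrite !formE !mulfE !partialE//.
rewrite (@deriveM _ _ f (fun y => r y s)); last 2 first.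
- exact: smooth_derivable (sfunP f) Ux.
- exact: form_derivable.
by rewrite addrC /GRing.scale/= [_ * 'D_v f x]mulrC.
Qed.

Definition ext_raw (g : E -> seq E -> R) x s : R :=
  \sum_(l < size s) (-1) ^+ l *
    'D_(s`_l) (fun y => g y (take l s ++ drop l.+1 s)) x.

(** Cartan's formula for a constant vector field; it holds for any family of
    functions [g], which allows its use in the proof that [d] preserves
    alternating forms. *)
Lemma ext_raw_cons g x v s :
  ext_raw g x (v :: s) =
  'D_v (fun y => g y s) x - ext_raw (fun y t => g y (v :: t)) x s.
Proof.
rewrite /ext_raw big_ord_recl /= expr0 mul1r drop0; congr (_ + _).
rewrite -sumrN; apply: eq_bigr => l _.
by rewrite /bump /= add1n exprS mulN1r mulNr.
Qed.

Lemma ext_raw_linear a r (t : form) x s : U x ->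
  ext_raw (a *: r + t) x s = a * ext_raw r x s + ext_raw t x s.
Proof.
move=> Ux; rewrite /ext_raw mulr_sumr -big_split; apply: eq_bigr => l _ /=.
by rewrite derive_formP//; ring.
Qed.

Lemma derive_direction r s x a u v : U x ->
  'D_(a *: u + v) (fun y => r y s) x =
  a * 'D_u (fun y => r y s) x + 'D_v (fun y => r y s) x.
Proof.
move=> Ux; have df := smooth_differentiable (form_smooth r s) Ux.
by rewrite !deriveE// linearP.
Qed.

Lemma ext_raw_multilinear r x s t a u v : U x ->
  ext_raw r x (s ++ (a *: u + v) :: t) =
  a * ext_raw r x (s ++ u :: t) + ext_raw r x (s ++ v :: t).
Proof.
move=> Ux; elim: s r => [|w s IH] r; rewrite /= !ext_raw_cons.
  rewrite derive_direction//.
  have -> : (fun y q => r y ((a *: u + v) :: q)) =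
      (a *: iota u r + iota v r : form) by rewrite -iotaP.
  by rewrite ext_raw_linear//; ring.
have [-> _] := partial_alternating w r Ux.
by rewrite (IH (iota w r)) /=; ring.
Qed.

Lemma ext_raw_swap r x s u v : U x ->
  ext_raw r x (u :: v :: s) = - ext_raw r x (v :: u :: s).
Proof.
move=> Ux; rewrite !ext_raw_cons /=.
have -> : (fun y q => r y [:: u, v & q]) =
    (- 1 *: iota u (iota v r) + 0 : form).
  by rewrite addr0 scaleN1r -iotaC.
rewrite ext_raw_linear//.
have -> : ext_raw (0 : form) x s = 0.
  by rewrite /ext_raw big1// => l _; rewrite derive_cst mulr0.
by rewrite /=; ring.
Qed.

Lemma ext_raw_alternating r x s t q u : U x ->
  ext_raw r x (s ++ u :: t ++ u :: q) = 0.
Proof.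
move=> Ux; elim: s r => [|w s IH] r; last first.
  rewrite /= ext_raw_cons (partial_alternating w r Ux).2.
  by rewrite (IH (iota w r)) subr0.
elim: t r => [|w t IH] r /=; last first.
  rewrite ext_raw_swap// ext_raw_cons ((partial_alternating w r Ux).2 [::]).
  by rewrite (IH (iota w r)) subr0 oppr0.
have /eqP := @ext_raw_swap r x q u u Ux.
by rewrite -addr_eq0 -mulr2n mulrn_eq0 => /eqP.
Qed.

Lemma ext_raw_smooth r s : smooth_on U (fun x => ext_raw r x s).
Proof.
have oU := open_carrierP O.
apply: smooth_sum => // l; apply: smoothM => //; first exact: smooth_cst.
exact/smooth_derive/form_smooth.
Qed.

Definition extd r : form :=
  restriction (fun x Ux =>
      conj (fun s t a u v => ext_raw_multilinear r s t a u v Ux)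
           (fun s t q u => ext_raw_alternating r s t q u Ux))
    (ext_raw_smooth r).

Lemma extdE r x s : U x -> extd r x s = ext_raw r x s.
Proof. exact: restrictionE. Qed.

Lemma extd_linear : linear extd.
Proof.
move=> a r t; apply: form_eq => x s Ux; rewrite !formE !extdE//.
exact: ext_raw_linear.
Qed.
HB.instance Definition _ :=
  GRing.isLinear.Build R form form _ extd extd_linear.

Lemma extd_nil r x : U x -> extd r x [::] = 0.
Proof. by move=> Ux; rewrite extdE// /ext_raw big_ord0. Qed.

Lemma iota_extd v r : iota v (extd r) = partial v r - extd (iota v r).
Proof.
apply: form_eq => x s Ux.
by rewrite !formE iotaE !extdE// partialE// ext_raw_cons.
Qed.

Lemma partial_extd v r : partial v (extd r) = extd (partial v r).
Proof.
apply/eqP; rewrite -subr_eq0; apply/eqP; move: r.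
apply: form_ind_eq0 => [r x Ux|u r].
  rewrite !formE extd_nil// subr0 partialE//.
  have E0 : {in U, (fun y => extd r y [::]) =1 (fun=> 0)}.
    by move=> y; rewrite inE => Uy; exact: extd_nil.
  have Ux' : x \in U by rewrite inE.
  by rewrite (eq_on_derive (open_carrierP O) v E0 Ux') derive_cst.
exists (-1); rewrite scaleN1r linearB/= -!partial_iota !iota_extd.
rewrite linearB/= -!partial_iota (partialC u).
by apply: form_eq => x s Ux; rewrite !formE; ring.
Qed.

Lemma extd_extd r : extd (extd r) = 0.
Proof.
move: r; apply: form_ind_eq0 => [r x Ux|v r]; first exact: extd_nil.
exists 1; rewrite scale1r !iota_extd linearB/= partial_extd.
by rewrite opprB addrC subrK.
Qed.

(** The commutator of [d] and [f] is the multiplication with [df], which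
    commutes with the multiplication by [g]. *)
Lemma extd_mulf_mulf f g r :
  extd (mulf f (mulf g r)) - mulf g (extd (mulf f r)) =
  mulf f (extd (mulf g r)) - mulf f (mulf g (extd r)).
Proof.
apply/eqP; rewrite -subr_eq0; apply/eqP; move: r.
apply: form_ind_eq0 => [r x Ux|v r].
  by rewrite !formE !mulfE !extd_nil// !mulr0 !subr0.
exists (-1); rewrite scaleN1r !linearB/=.
rewrite !(iota_mulf, iota_extd, partial_mulf).
by apply: form_eq => x s Ux; rewrite !(formE, mulfE) /=; ring.
Qed.

End Forms.

(** * Zero-order operators on forms *)

Section Permutation.
Context {R : realType} {V : lmodType R}.
Implicit Types (f : seq V -> R) (p s a b : seq V).

Lemma alternating_move f p a v s : alternating_multilinear f ->
  f (p ++ a ++ v :: s) = (-1) ^+ size a * f (p ++ v :: a ++ s).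
Proof.
move=> fP; elim: a p => [|w a IH] p /=; first by rewrite expr0 mul1r.
by rewrite -cat_rcons IH cat_rcons (alternating_swap fP) exprS; ring.
Qed.

Lemma alternating_catCA f p a b s : alternating_multilinear f ->
  f (p ++ a ++ b ++ s) = (-1) ^+ (size a * size b) * f (p ++ b ++ a ++ s).
Proof.
move=> fP; elim: b p => [|v b IH] p /=; first by rewrite muln0 mul1r.
by rewrite alternating_move// -cat_rcons IH cat_rcons mulnS exprD mulrA.
Qed.

Lemma alternating_perm a b : perm_eq a b ->
  exists e : R, forall f s, alternating_multilinear f ->
    f (a ++ s) = e * f (b ++ s).
Proof.
move=> ab; pose P c := exists e : R, forall f s, alternating_multilinear f ->
  f (a ++ s) = e * f (c ++ s).
have P_a : P a by exists 1 => f s _; rewrite mul1r.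
apply: (catCA_perm_ind (P := P) _ ab P_a).
move=> s1 s2 s3 [e eP].
exists (e * (-1) ^+ (size s1 * size s2)) => f s fP.
by rewrite eP// -!catA (alternating_catCA [::])// mulrA.
Qed.

Lemma alternating_dup f p a : alternating_multilinear f -> ~~ uniq a ->
  forall s, f (p ++ a ++ s) = 0.
Proof.
move=> [_ alt]; elim: a p => //= v a IH p.
rewrite negb_and negbK => /orP[/splitPr[q r] s|ua s].
  by rewrite -catA; exact: alt.
by rewrite -cat_rcons IH.
Qed.

End Permutation.

Section Frame.
Context {R : realType} {n : nat}.
Local Notation E := 'rV[R]_n.

Definition frame (a : seq 'I_n) : seq E := [seq delta_mx 0 j | j <- a].

Lemma frame_cat a b : frame (a ++ b) = frame a ++ frame b.
Proof. exact: map_cat. Qed.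

Lemma frame_uniq a : ~~ uniq a -> ~~ uniq (frame a).
Proof. by apply: contra => /map_uniq. Qed.

(** Every word in the basis vectors is, up to a sign, the decreasing word on a
    set of indices, or repeats a letter. *)
Lemma frame_normal_form a : exists c : {set 'I_n} -> R,
  forall f s, alternating_multilinear f ->
    f (frame a ++ s) =
    \sum_(I : {set 'I_n}) c I * f (rev (frame (enum I)) ++ s).
Proof.
have [ua|nua] := boolP (uniq a); last first.
  exists (fun=> 0) => f s fP; rewrite big1 => [|I _]; last by rewrite mul0r.
  exact: (alternating_dup [::] fP (frame_uniq nua)).
pose A := [set j in a].
have /alternating_perm[e eP] : perm_eq (frame a) (rev (frame (enum A))).
  rewrite perm_sym perm_rev; apply: perm_map; apply: uniq_perm => //.
    exact: enum_uniq.
  by move=> j; rewrite mem_enum inE.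
exists (fun I => if I == A then e else 0) => f s fP.
rewrite (bigD1 A)//= eqxx big1 ?addr0 ?eP// => I /negbTE ->.
by rewrite mul0r.
Qed.

Section Nondegenerate.
Context {f : seq E -> R}.
Hypothesis fP : alternating_multilinear f.

Lemma frame_expansion a s : f (frame a ++ s) != 0 ->
  exists2 b, size b = size s & f (frame (a ++ b)) != 0.
Proof.
elim: s a => [|v s IH] a; first by exists [::]; rewrite ?cats0// cats0 in H *.
rewrite [v]row_sum_delta (multilinear_sum fP) => /negP nz.
have [/existsP[j]|] := boolP [exists j, f (frame (rcons a j) ++ s) != 0].
  move=> /IH[b bs]; rewrite cat_rcons => fb.
  by exists (j :: b) => //=; rewrite bs.
rewrite negb_exists => /forallP z; case: nz; apply/eqP; rewrite big1// => j _.
rewrite (multilinearZ fP).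
have /negPn/eqP := z j; rewrite /frame map_rcons cat_rcons => ->.
by rewrite mulr0.
Qed.

Hypothesis f_top : forall s, size s != n -> f s = 0.
Hypothesis f_neq0 : exists s, f s != 0.

Lemma top_frame_neq0 (I : {set 'I_n}) :
  f (rev (frame (enum I)) ++ frame (enum (~: I))) != 0.
Proof.
have [s fs] := f_neq0.
have sn : size s = n by apply/eqP/negPn/negP => /f_top; exact/eqP.
have [b bs fb] := frame_expansion (a := [::]) fs.
have ub : uniq b.
  apply/negPn/negP => /frame_uniq nub; move/eqP: fb; apply.
  by have := alternating_dup [::] fP nub [::]; rewrite cats0.
have pb : perm_eq (frame b) (rev (frame (enum I)) ++ frame (enum (~: I))).
  rewrite /frame -map_rev -map_cat; apply: perm_map; apply: uniq_perm => //.
    rewrite cat_uniq rev_uniq !enum_uniq /= andbT -all_predC.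
    by apply/allP => j; rewrite mem_enum inE /= mem_rev mem_enum.
  move=> j; rewrite mem_cat mem_rev !mem_enum inE orbN.
  have /uniq_min_size := ub; move=> /(_ (enum 'I_n)).
  case=> [k _||_ ->]; first by rewrite mem_enum.
    by rewrite size_enum_ord bs sn.
  by rewrite mem_enum.
have [e /(_ f [::] fP)] := alternating_perm pb.
by rewrite !cats0 => fE; move: fb; rewrite /= fE mulf_eq0 negb_or => /andP[].
Qed.

(** Testing the contraction on the basis vectors outside [I] isolates the
    coefficient of [I]: every other term repeats a vector or has the wrong
    degree. *)
Lemma frame_coef_eq0 (c : {set 'I_n} -> R) :
  (forall s, \sum_I c I * f (rev (frame (enum I)) ++ s) = 0) ->
  forall I, c I = 0.
Proof.
move=> c0 I; have := c0 (frame (enum (~: I))).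
rewrite (bigD1 I)//= big1 ?addr0 => [/eqP|J JI].
  by rewrite mulf_eq0 (negbTE (top_frame_neq0 I)) orbF => /eqP.
have [JE|/eqP JE] := eqVneq #|J| #|I|; last first.
  rewrite f_top ?mulr0// size_cat size_rev !size_map -!cardE.
  have In : (#|I| + #|~: I| = n)%N by rewrite cardsC card_ord.
  by apply/eqP => Jn; apply: JE; apply: (@addIn #|~: I|); rewrite Jn.
suff nu : ~~ uniq (rev (enum J) ++ enum (~: I)).
  have := alternating_dup [::] fP (frame_uniq nu) [::].
  by rewrite frame_cat {1}/frame map_rev cats0 => ->; rewrite mulr0.
rewrite cat_uniq rev_uniq !enum_uniq /= andbT negbK; apply/hasP.
have /subsetPn[j jJ jI] : ~~ (J \subset I).
  by apply: contra JI => JI; rewrite eqEcard JI JE leqnn.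
by exists j; rewrite ?mem_enum ?inE// mem_rev mem_enum.
Qed.

End Nondegenerate.

Lemma top_degree_eq0 (f : seq E -> R) : alternating_multilinear f ->
  (forall s, size s != n.+1 -> f s = 0) -> forall s, f s = 0.
Proof.
move=> fP f_top s; apply/eqP/negPn/negP => fs.
have sn : size s = n.+1 by apply/eqP/negPn/negP => /f_top; exact/eqP.
have [b bs fb] := frame_expansion fP (a := [::]) fs.
have [ub|/frame_uniq nub] := boolP (uniq b).
  have := uniq_leq_size ub (fun j _ => mem_enum 'I_n j).
  by rewrite size_enum_ord bs sn ltnn.
move/eqP: fb; apply.
by have := alternating_dup [::] fP nub [::]; rewrite cats0.
Qed.

End Frame.

Section Contractions.
Context {R : realType} {n : nat} {O : open_set R n}.
Local Notation E := 'rV[R]_n.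
Local Notation U := (open_carrier O).
Local Notation form := (form O).
Local Notation e_ j := (delta_mx 0 j : E).
Implicit Types (r : form) (Phi Psi : form -> form).

(** The operators that act at each point by the insertion of a multivector. Only
    the existence of its components is asserted, so that sums over unordered or
    repeated indices need not be brought to a normal form. *)
Definition contraction Phi : Prop :=
  forall x, U x -> exists c : {set 'I_n} -> R, forall r s,
    Phi r x s = \sum_I c I * r x (rev (frame (enum I)) ++ s).

(** All components of the multivector can be read off from its insertion into a
    volume form. *)
Lemma contraction_eq0 Phi (w : form) : contraction Phi ->
  (forall x s, size s != n -> w x s = 0) ->
  (forall x, U x -> exists s, w x s != 0) ->
  Phi w = 0 -> forall r, Phi r = 0.
Proof.
move=> Phic w_top w_neq0 Phiw r; apply: form_eq => x s Ux.
have [c cE] := Phic x Ux.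
rewrite form0 cE big1// => I _.
have w_alt := form_alternating w x.
rewrite (frame_coef_eq0 w_alt (w_top x) (w_neq0 x Ux)) ?mul0r//.
by move=> s'; rewrite -cE Phiw.
Qed.

Lemma contraction_word Phi (a : seq 'I_n) :
  (forall r x s, Phi r x s = r x (frame a ++ s)) -> contraction Phi.
Proof.
move=> PhiE x Ux; have [c cE] := frame_normal_form (R := R) a.
by exists c => r s; rewrite PhiE cE//; exact: form_alternating.
Qed.

Lemma contractionD Phi Psi : contraction Phi -> contraction Psi ->
  contraction (fun r => Phi r + Psi r).
Proof.
move=> PhiP PsiP x Ux; have [c cE] := PhiP x Ux; have [d dE] := PsiP x Ux.
exists (fun I => c I + d I) => r s; rewrite formE cE dE -big_split.
by apply: eq_bigr => I _ /=; ring.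
Qed.

Lemma contraction_mulf f Phi : contraction Phi ->
  contraction (fun r => mulf f (Phi r)).
Proof.
move=> PhiP x Ux; have [c cE] := PhiP x Ux.
exists (fun I => f x * c I) => r s; rewrite mulfE cE mulr_sumr.
by apply: eq_bigr => I _ /=; ring.
Qed.

Lemma contractionN Phi : contraction Phi -> contraction (fun r => - Phi r).
Proof.
move=> PhiP x Ux; have [c cE] := PhiP x Ux.
exists (fun I => - c I) => r s; rewrite formE cE -sumrN.
by apply: eq_bigr => I _ /=; ring.
Qed.

Lemma contraction_sum (I : Type) (l : seq I) (F : I -> form -> form) :
  (forall i, contraction (F i)) ->
  contraction (fun r => \sum_(i <- l) F i r).
Proof.
move=> FP; elim: l => [|i l IH].
  move=> x Ux; exists (fun=> 0) => r s; rewrite big_nil form0 big1// => J _.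
  by rewrite mul0r.
have -> : (fun r => \sum_(k <- i :: l) F k r) =
    (fun r => F i r + \sum_(k <- l) F k r).
  by apply/funext => r; rewrite big_cons.
exact: contractionD (FP i) IH.
Qed.

Lemma contraction_combine Phi x (T : {set 'I_n} -> seq 'I_n) c :
  (forall r s, Phi r x s = \sum_I c I * r x (frame (T I) ++ s)) ->
  exists d : {set 'I_n} -> R, forall r s,
    Phi r x s = \sum_I d I * r x (rev (frame (enum I)) ++ s).
Proof.
move=> PhiE.
have /choice[d dE] : forall I, exists d : {set 'I_n} -> R, forall f s,
    alternating_multilinear f -> f (frame (T I) ++ s) =
      \sum_J d J * f (rev (frame (enum J)) ++ s).
  by move=> I; exact: frame_normal_form.
exists (fun J => \sum_I c I * d I J) => r s; rewrite PhiE.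
rewrite (eq_bigr (fun I => \sum_J c I *
    (d I J * r x (rev (frame (enum J)) ++ s)))); last first.
  by move=> I _; rewrite (dE I _ _ (form_alternating r x)) mulr_sumr.
rewrite exchange_big; apply: eq_bigr => J _ /=.
by rewrite mulr_suml; apply: eq_bigr => I _; rewrite mulrA.
Qed.

Lemma contraction_iotal j Phi : contraction Phi ->
  contraction (fun r => iota (e_ j) (Phi r)).
Proof.
move=> PhiP x Ux; have [c cE] := PhiP x Ux.
apply: (contraction_combine (T := fun I => rcons (rev (enum I)) j) (c := c)).
move=> r s; rewrite iotaE cE; apply: eq_bigr => I _.
by rewrite /frame map_rcons cat_rcons map_rev.
Qed.

Lemma contraction_iotar j Phi : contraction Phi ->
  contraction (fun r => Phi (iota (e_ j) r)).
Proof.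
move=> PhiP x Ux; have [c cE] := PhiP x Ux.
apply: (contraction_combine (T := fun I => j :: rev (enum I)) (c := c)).
move=> r s; rewrite cE; apply: eq_bigr => I _.
by rewrite iotaE /= /frame map_rev.
Qed.

Lemma contraction_iota2 i j :
  contraction (fun r => iota (e_ i) (iota (e_ j) r)).
Proof. exact: (contraction_word (a := [:: j; i])). Qed.

Lemma extd_top (w : form) : (forall x s, size s != n -> w x s = 0) ->
  extd w = 0.
Proof.
move=> w_top; apply: form_eq => x s Ux; rewrite form0.
apply: (top_degree_eq0 (form_alternating (extd w) x)) => q qn.
rewrite extdE// /ext_raw big1// => l _.
rewrite (_ : (fun y => _) = fun=> 0) ?derive_cst ?mulr0//.
apply/funext => y; rewrite w_top// size_cat size_takel ?size_drop; last first.
  exact: ltnW.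
apply: contra qn => /eqP ln; apply/eqP.
by rewrite -[in RHS]ln -addnS -subSn// subSS subnKC// ltnW.
Qed.

(** * The local Cartan calculus of a bivector *)

Definition insv (X : 'I_n -> smooth_fun O) r : form :=
  \sum_j mulf (X j) (iota (e_ j) r).

(** The bivector is the sum of the p_ij e_i /\ e_j over all pairs of indices, so
    that the components of a multivector field enter through their upper
    triangle. *)
Definition insb (p : 'I_n -> 'I_n -> smooth_fun O) r : form :=
  \sum_i \sum_j mulf (p i j) (iota (e_ i) (iota (e_ j) r)).

Lemma insv_linear X : linear (insv X).
Proof.
move=> a r t; rewrite /insv scaler_sumr -big_split; apply: eq_bigr => j _.
by rewrite !linearP.
Qed.
HB.instance Definition _ X :=
  GRing.isLinear.Build R form form _ (insv X) (insv_linear X).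

Lemma insb_linear p : linear (insb p).
Proof.
move=> a r t; rewrite /insb scaler_sumr -big_split; apply: eq_bigr => i _.
rewrite scaler_sumr -big_split; apply: eq_bigr => j _.
by rewrite !linearP.
Qed.
HB.instance Definition _ p :=
  GRing.isLinear.Build R form form _ (insb p) (insb_linear p).

(** The Lie derivatives along a bivector and along a vector field are graded
    commutators with [d], whence the two signs. *)
Definition lieb p r : form := insb p (extd r) - extd (insb p r).
Definition liev X r : form := insv X (extd r) + extd (insv X r).

Lemma lieb_linear p : linear (lieb p).
Proof.
move=> a r t; rewrite /lieb !linearP.
by apply: form_eq => x s _; rewrite !formE; ring.
Qed.
HB.instance Definition _ p :=
  GRing.isLinear.Build R form form _ (lieb p) (lieb_linear p).

Lemma liev_linear X : linear (liev X).
Proof.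
move=> a r t; rewrite /liev !linearP.
by apply: form_eq => x s _; rewrite !formE; ring.
Qed.
HB.instance Definition _ X :=
  GRing.isLinear.Build R form form _ (liev X) (liev_linear X).

(** ** The case of a single term *)

Definition lie1 (f : smooth_fun O) (a b : E) r : form :=
  mulf f (iota a (iota b (extd r))) - extd (mulf f (iota a (iota b r))).

Lemma lieb_sum p r : lieb p r = \sum_i \sum_j lie1 (p i j) (e_ i) (e_ j) r.
Proof.
rewrite /lieb /insb raddf_sum -sumrB; apply: eq_bigr => i _.
by rewrite raddf_sum -sumrB.
Qed.

Lemma iota2_extd a b r : iota a (iota b (extd r)) =
  partial b (iota a r) - partial a (iota b r) + extd (iota a (iota b r)).
Proof.
rewrite iota_extd linearB/= iota_extd -partial_iota.
by apply: form_eq => x s _; rewrite !formE; ring.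
Qed.

(** The derivatives of the form cancel, so that the commutator is a
    zero-order operator. *)
Lemma lie1_iota f g a b c r :
  lie1 f a b (mulf g (iota c r)) + mulf g (iota c (lie1 f a b r)) =
  mulf f (mulf (sfun_derive g b) (iota a (iota c r))) -
  mulf f (mulf (sfun_derive g a) (iota b (iota c r))) -
  mulf g (mulf (sfun_derive f c) (iota a (iota b r))).
Proof.
pose z := iota a (iota b (iota c r)).
have zE : iota c (iota a (iota b r)) = z.
  by rewrite iotaC (iotaC c) linearN opprK.
rewrite /lie1 !iota2_extd linearB/= !iota_mulf iota_extd !iota_mulf zE.
rewrite 2!(linearD (iota c))/= (linearN (iota c))/= -!partial_iota iota_extd zE.
rewrite (iotaC c a) (iotaC c b) !partial_mulf -/z.
rewrite (linearN (partial a)) (linearN (partial b)).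
apply: form_eq => x s _; rewrite !(formE, mulfE).
have := congr1 (fun t : form => t x s) (extd_mulf_mulf f g z).
rewrite !(formE, mulfE) => /eqP; rewrite subr_eq => /eqP ->.
by ring.
Qed.

Lemma lie1_mulf f g a b r :
  lie1 f a b (mulf g r) - mulf g (lie1 f a b r) =
  mulf f (mulf (sfun_derive g b) (iota a r)) -
  mulf f (mulf (sfun_derive g a) (iota b r)).
Proof.
rewrite /lie1 !iota2_extd !iota_mulf !partial_mulf.
apply: form_eq => x s _; rewrite !(formE, mulfE).
have := congr1 (fun t : form => t x s)
  (extd_mulf_mulf f g (iota a (iota b r))).
rewrite !(formE, mulfE) => /eqP; rewrite subr_eq => /eqP ->.
by ring.
Qed.

(** ** Insertion of vector fields and bivector fields *)

Lemma insv_insv X Y r : insv X (insv Y r) =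
  \sum_i \sum_j mulf (X i) (mulf (Y j) (iota (e_ i) (iota (e_ j) r))).
Proof.
rewrite {1}/insv; apply: eq_bigr => i _; rewrite /insv !raddf_sum.
by apply: eq_bigr => j _ /=; rewrite iota_mulf.
Qed.

Lemma insvC X Y r : insv X (insv Y r) = - insv Y (insv X r).
Proof.
rewrite !insv_insv exchange_big -sumrN; apply: eq_bigr => j _.
rewrite -sumrN; apply: eq_bigr => i _ /=.
by rewrite mulfC iotaC !linearN.
Qed.

Lemma insv_sq X r : insv X (insv X r) = 0.
Proof.
by apply: form_opp_eq0; exact: insvC.
Qed.

Lemma insv_mulf X f r : insv X (mulf f r) = mulf f (insv X r).
Proof.
rewrite /insv raddf_sum; apply: eq_bigr => j _ /=.
by rewrite iota_mulf mulfC.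
Qed.

Lemma insb_insv p X r : insb p (insv X r) = insv X (insb p r).
Proof.
rewrite /insb !raddf_sum; apply: eq_bigr => i _.
rewrite !raddf_sum; apply: eq_bigr => j _ /=.
rewrite /insv !raddf_sum; apply: eq_bigr => k _ /=.
rewrite !iota_mulf mulfC; congr (mulf _ (mulf _ _)).
by rewrite (iotaC (e_ j)) linearN/= iotaC opprK.
Qed.

Lemma liev_mulf X g r :
  liev X (mulf g r) - mulf g (liev X r) =
  \sum_j mulf (X j) (mulf (sfun_derive g (e_ j)) r).
Proof.
rewrite /liev /insv !raddf_sum -!big_split raddf_sum -sumrB.
apply: eq_bigr => j _ /=.
rewrite linearD/= !(iota_mulf, iota_extd, partial_mulf).
apply: form_eq => x s _; rewrite !(formE, mulfE).
have := congr1 (fun t : form => t x s) (extd_mulf_mulf (X j) g (iota (e_ j) r)).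
rewrite !(formE, mulfE) => /eqP; rewrite subr_eq => /eqP ->.
by ring.
Qed.

Lemma lieb_mulf p g r :
  lieb p (mulf g r) - mulf g (lieb p r) =
  \sum_i \sum_j
    (mulf (p i j) (mulf (sfun_derive g (e_ j)) (iota (e_ i) r)) -
     mulf (p i j) (mulf (sfun_derive g (e_ i)) (iota (e_ j) r))).
Proof.
rewrite !lieb_sum raddf_sum -sumrB; apply: eq_bigr => i _.
by rewrite raddf_sum -sumrB; apply: eq_bigr => j _; exact: lie1_mulf.
Qed.

Lemma contraction_lieb_iota p g k : contraction (fun r =>
  lieb p (mulf g (iota (e_ k) r)) + mulf g (iota (e_ k) (lieb p r))).
Proof.
have -> : (fun r => lieb p (mulf g (iota (e_ k) r)) +
                    mulf g (iota (e_ k) (lieb p r))) =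
  (fun r => \sum_i \sum_j
    (mulf (p i j) (mulf (sfun_derive g (e_ j)) (iota (e_ i) (iota (e_ k) r))) -
     mulf (p i j) (mulf (sfun_derive g (e_ i)) (iota (e_ j) (iota (e_ k) r))) -
     mulf g (mulf (sfun_derive (p i j) (e_ k)) (iota (e_ i) (iota (e_ j) r))))).
  apply/funext => r; rewrite !lieb_sum !raddf_sum -big_split.
  apply: eq_bigr => i _ /=; rewrite !raddf_sum -big_split.
  by apply: eq_bigr => j _ /=; exact: lie1_iota.
apply: contraction_sum => i; apply: contraction_sum => j.
have c2 f h a b :
    contraction (fun r => mulf f (mulf h (iota (e_ a) (iota (e_ b) r)))).
  exact/contraction_mulf/contraction_mulf/contraction_iota2.
by apply: contractionD; [apply: contractionD|]; rewrite //; exact: contractionN.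
Qed.

(** The multivector is the Schouten bracket of [p] and [X]. *)
Lemma contraction_lieb_insv p X : contraction (fun r =>
  lieb p (insv X r) + insv X (lieb p r)).
Proof.
have -> : (fun r => lieb p (insv X r) + insv X (lieb p r)) = (fun r => \sum_k
    (lieb p (mulf (X k) (iota (e_ k) r)) +
     mulf (X k) (iota (e_ k) (lieb p r)))).
  by apply/funext => r; rewrite /insv raddf_sum -big_split.
by apply: contraction_sum => k; exact: contraction_lieb_iota.
Qed.

(** The multivector is the Schouten bracket of [p] and [q]. Moving [lieb p] past
    one insertion after the other reduces this to [contraction_lieb_iota]. *)
Lemma contraction_lieb_insb p q : contraction (fun r =>
  lieb p (insb q r) - insb q (lieb p r)).
Proof.
pose one : smooth_fun O := SmoothFun (@smooth_cst R _ U 1).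
have oneE r : mulf one r = r.
  by apply: form_eq => x s _; rewrite mulfE mul1r.
have -> : (fun r => lieb p (insb q r) - insb q (lieb p r)) =
  (fun r => \sum_i \sum_j
    ((lieb p (mulf (q i j) (iota (e_ i) (iota (e_ j) r))) +
       mulf (q i j) (iota (e_ i) (lieb p (iota (e_ j) r)))) -
     mulf (q i j) (iota (e_ i) (lieb p (mulf one (iota (e_ j) r)) +
       mulf one (iota (e_ j) (lieb p r)))))).
  apply/funext => r; rewrite /insb raddf_sum -sumrB; apply: eq_bigr => i _.
  rewrite raddf_sum -sumrB; apply: eq_bigr => j _ /=.
  rewrite !oneE (linearD (iota (e_ i)) (lieb p (iota (e_ j) r))).
  by rewrite (linearD (mulf (q i j))) addrKA.
apply: contraction_sum => i; apply: contraction_sum => j; apply: contractionD.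
  exact: (contraction_iotar j (contraction_lieb_iota p (q i j) i)).
apply/contractionN/contraction_mulf/contraction_iotal.
exact: contraction_lieb_iota.
Qed.

End Contractions.

(** * The modular vector field and the perturbed Poisson bivector *)

Section ModularField.
Context {R : realType} {n : nat} {O : open_set R n}.
Local Notation E := 'rV[R]_n.
Local Notation U := (open_carrier O).
Local Notation form := (form O).
Context {p : 'I_n -> 'I_n -> smooth_fun O} {X Y : 'I_n -> smooth_fun O}.
Context {nu : smooth_fun O} {w : form}.
Implicit Types r : form.

Local Notation d := (@extd R n O).
Local Notation iP := (insb p).
Local Notation iX := (insv X).
Local Notation iY := (insv Y).
Local Notation LP := (lieb p).
Local Notation LX := (liev X).
Local Notation LY := (liev Y).

Hypothesis w_top : forall x s, size s != n -> w x s = 0.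
Hypothesis w_neq0 : forall x, U x -> exists s, w x s != 0.
Hypothesis jacobi_w : LP (iP w) - iP (LP w) = 0.
Hypothesis X_modular : iX w = d (iP w).
Hypothesis X_nu : forall r,
  \sum_j mulf (X j) (mulf (sfun_derive nu (delta_mx 0 j)) r) = r.
Hypothesis Y_hamiltonian : forall r, iY r = LP (mulf nu r) - mulf nu (LP r).

Lemma extd_w : d w = 0. Proof. exact: extd_top. Qed.

Lemma extd_nu_w : d (mulf nu w) = 0.
Proof. by apply: extd_top => x s sn; rewrite mulfE w_top// mulr0. Qed.

Lemma lieb_insb r : LP (iP r) = iP (LP r).
Proof.
apply/eqP; rewrite -subr_eq0; apply/eqP; move: r.
exact: contraction_eq0 (contraction_lieb_insb p p) w_top w_neq0 jacobi_w.
Qed.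

Lemma lieb_extd r : LP (d r) = - d (LP r).
Proof.
by rewrite /lieb extd_extd (linear0 iP)/= sub0r (linearB d)/= extd_extd subr0.
Qed.

(** In LP (LP r) = LP (iP (d r)) - LP (d (iP r)), the operator [LP]
    commutes with [iP] and anticommutes with [d]: the right-hand side is
    - LP (LP r). *)
Lemma lieb_lieb r : LP (LP r) = 0.
Proof.
have E : LP (iP (d r) - d (iP r)) = - iP (d (LP r)) + d (iP (LP r)).
  by rewrite (linearB LP)/= lieb_insb !lieb_extd lieb_insb (linearN iP) opprK.
by apply: form_opp_eq0; apply: (etrans E); rewrite addrC -opprB.
Qed.

Lemma lieb_w : LP w = - iX w.
Proof. by rewrite /lieb extd_w (linear0 iP)/= sub0r X_modular. Qed.

(** The modular vector field is an infinitesimal automorphism of [P]: the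
    bracket of [P] with [X] acts on [w] as - LP (LP w) - iX (iX w). *)
Lemma lieb_insv r : LP (iX r) = - iX (LP r).
Proof.
apply/eqP; rewrite -addr_eq0; apply/eqP; move: r.
apply: contraction_eq0 (contraction_lieb_insv p X) w_top w_neq0 _.
have -> : iX w = - LP w by rewrite lieb_w opprK.
by rewrite (linearN LP)/= lieb_lieb lieb_w (linearN iX)/= insv_sq !oppr0 addr0.
Qed.

Lemma liev_lieb r : LX (LP r) = LP (LX r).
Proof.
rewrite /liev (linearD LP)/= lieb_insv !lieb_extd lieb_insv.
by rewrite (linearN iX)/= (linearN d)/= !opprK.
Qed.

Lemma liev_nu r : LX (mulf nu r) = mulf nu (LX r) + r.
Proof. by apply/eqP; rewrite addrC -subr_eq liev_mulf X_nu. Qed.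

(** [LX] commutes with [LP], and its commutator with [nu] is the constant 1, so
    that it commutes with their commutator [iY]. *)
Lemma liev_insvY r : LX (iY r) = iY (LX r).
Proof.
rewrite !Y_hamiltonian (linearB LX)/= liev_nu !liev_lieb liev_nu (linearD LP)/=.
by rewrite opprD addrACA subrr addr0.
Qed.

Lemma lieb_insvY r : LP (iY r) = - iY (LP r).
Proof.
rewrite !Y_hamiltonian (linearB LP)/= !lieb_lieb (linear0 (mulf nu))/=.
by rewrite sub0r subr0.
Qed.

(** As operators, the brackets of [X] with [Y] and of [Y] with [X] are opposite,
    and the former vanishes by [liev_insvY]. *)
Lemma liebY_insv r : LY (iX r) = iX (LY r).
Proof.
have := liev_insvY r; rewrite /liev (linearD iX)/= (linearD iY)/=.
rewrite (insvC Y X r) (linearN d)/= (insvC Y X (d r)) => E0.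
apply: form_eq => x s _; have := congr1 (fun t : form => t x s) E0.
rewrite !formE; lra.
Qed.

(** [insq] is the insertion of X /\ Y, [lieq] the Lie derivative along it. *)
Definition insq r : form := iX (iY r).
Lemma insq_linear : linear insq.
Proof. by move=> a r t; rewrite /insq !linearP. Qed.
HB.instance Definition _ :=
  GRing.isLinear.Build R form form _ insq insq_linear.

Definition lieq r : form := insq (d r) - d (insq r).

Lemma lieq_linear : linear lieq.
Proof.
move=> a r t; rewrite /lieq !linearP.
by apply: form_eq => x s _; rewrite !formE; ring.
Qed.
HB.instance Definition _ :=
  GRing.isLinear.Build R form form _ lieq lieq_linear.

Lemma insq_insb r : iP (insq r) = insq (iP r).
Proof. by rewrite /insq !insb_insv. Qed.

Lemma lieqE r : lieq r = iX (LY r) - LX (iY r).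
Proof.
by rewrite /lieq /insq /liev (linearD iX)/= opprD addrA addrK.
Qed.

Lemma insvY_insq r : iY (insq r) = 0.
Proof. by rewrite /insq insvC insv_sq (linear0 iX)/= oppr0. Qed.

(** [X] and [Y] commute, and the bracket of X /\ Y with itself only involves
    the bracket of [X] and [Y]. *)
Lemma lieq_insq r : lieq (insq r) = insq (lieq r).
Proof.
apply/eqP; rewrite -subr_eq0; apply/eqP; rewrite !lieqE insvY_insq.
rewrite (linear0 LX)/= subr0 {1}/insq liebY_insv insv_sq sub0r.
rewrite /insq (linearB iY)/= -liev_insvY insv_sq (linear0 LX)/= subr0.
by rewrite insvC insv_sq (linear0 iY) !oppr0.
Qed.

Lemma lieb_insq r : LP (insq r) = insq (LP r).
Proof. by rewrite /insq lieb_insv lieb_insvY (linearN iX)/= opprK. Qed.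

(** By the Jacobi identity for operators the bracket is symmetric, as [iP] and
    [insq] commute. *)
Lemma lieq_insb r : lieq (iP r) = iP (lieq r).
Proof.
have e := lieb_insq r; apply/eqP; rewrite -subr_eq0 -(subrr (LP (insq r))) {2}e.
apply/eqP; rewrite /lieq /lieb (linearB insq)/= (linearB iP)/= !insq_insb.
rewrite [in LHS](opprB _ (iP _)) [in RHS](opprB _ (insq _)).
by rewrite [LHS]addrACA [RHS]addrACA [in RHS](addrC (iP _)).
Qed.

(** The insertion of a P + X /\ Y, and the Lie derivative along it: the
    constants 0, 1 and 2 give all the bivectors to be proved Poisson. *)
Definition insc (a : R) r : form := a *: iP r + insq r.
Definition liec a r : form := insc a (d r) - d (insc a r).

Lemma liecE a r : liec a r = a *: LP r + lieq r.
Proof.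
rewrite /liec /insc (linearD d)/= (linearZZ d)/= opprD addrACA.
by rewrite -scalerBr.
Qed.

Lemma liec_insc a r : liec a (insc a r) - insc a (liec a r) = 0.
Proof.
apply/eqP; rewrite subr_eq0; apply/eqP; rewrite !liecE /insc.
rewrite (linearD LP)/= (linearD lieq)/= (linearD iP)/= (linearD insq)/=.
rewrite (linearZZ LP)/= (linearZZ lieq)/= (linearZZ iP)/= (linearZZ insq)/=.
rewrite lieb_insb lieb_insq lieq_insb lieq_insq !scalerDr.
by rewrite addrACA.
Qed.

Lemma lieb_mul_insv r :
  LP (mulf nu (iX r)) + mulf nu (iX (LP r)) = iY (iX r).
Proof. by rewrite Y_hamiltonian lieb_insv (linearN (mulf nu))/= opprK. Qed.

Lemma liev_w : LX w = 0.
Proof. by rewrite /liev extd_w (linear0 iX)/= add0r X_modular extd_extd. Qed.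

(** Since d (LP (nu w)) = 0, the form LY w = d (iY w) reduces to d (nu (iX w)),
    which is the Lie derivative LX (nu w) = w. *)
Lemma lievY_w : LY w = w.
Proof.
rewrite /liev extd_w (linear0 iY)/= add0r Y_hamiltonian (linearB d)/=.
have -> : d (LP (mulf nu w)) = 0.
  by apply: oppr_inj; rewrite -lieb_extd extd_nu_w (linear0 LP)/= oppr0.
rewrite sub0r lieb_w (linearN (mulf nu))/= (linearN d)/= opprK.
have := liev_nu w; rewrite liev_w (linear0 (mulf nu))/= add0r => {2}<-.
rewrite /liev extd_nu_w (linear0 iX)/= add0r; congr (d _).
by rewrite insv_mulf.

Qed.

Lemma lieq_w : lieq w = - LP w.
Proof.
by rewrite lieqE lievY_w liev_insvY liev_w (linear0 iY)/= subr0 lieb_w opprK.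
Qed.

End ModularField.

(** * Sums over finite sets of indices *)

(** The terms i > j of the sum on the right are moved to the pairs i < j by
    exchanging the indices. *)
Lemma sum_antisym {R : comPzRingType} {n : nat} (F S : 'I_n -> 'I_n -> R) :
  (forall i j, S i j = - S j i) -> (forall i, S i i = 0) ->
  \sum_(i < n) \sum_(j < n) (if (i < j)%N then (F i j - F j i) * S i j else 0) =
  \sum_i \sum_j F i j * S i j.
Proof.
move=> SN S0.
pose lt (i j : 'I_n) (x : R) := if (i < j)%N then x else 0.
have -> : \sum_(i < n) \sum_(j < n)
      (if (i < j)%N then (F i j - F j i) * S i j else 0) =
    \sum_i \sum_j lt i j (F i j * S i j) + \sum_i \sum_j lt i j (F j i * S j i).
  rewrite -big_split; apply: eq_bigr => i _; rewrite -big_split.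
  apply: eq_bigr => j _; rewrite /lt /=; case: ifP => _; last by rewrite addr0.
  by rewrite (SN j i); ring.
rewrite [X in _ + X]exchange_big -big_split; apply: eq_bigr => i _.
rewrite -big_split; apply: eq_bigr => j _; rewrite /lt /=.
case: ltngtP => [_|_|/val_inj ->]; rewrite ?addr0 ?add0r//.
by rewrite S0 mulr0.
Qed.

Section SetSums.
Context {R : pzRingType} {n : nat}.
Implicit Types (F : seq 'I_n -> R) (I : {set 'I_n}).

(** Each term is a sum over t with at most one nonzero term, as [h] is injective;
    then the two sums are exchanged. *)
Lemma sum_by_enum F (T : finType) (h : T -> seq 'I_n) (dom : pred T) :
  (forall I : {set 'I_n}, F (enum I) != 0 -> exists2 t, dom t & h t = enum I) ->
  (forall t, dom t -> exists I : {set 'I_n}, enum I = h t) ->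
  injective h ->
  \sum_(I : {set 'I_n}) F (enum I) = \sum_(t | dom t) F (h t).
Proof.
move=> Fh hI h_inj.
have FE (I : {set 'I_n}) :
    F (enum I) = \sum_(t | dom t) if h t == enum I then F (h t) else 0.
  have [F0|/Fh[t Dt ht]] := eqVneq (F (enum I)) 0.
    by rewrite F0 big1// => t _; case: eqP => // ->.
  rewrite (bigD1 t)//= ht eqxx big1 ?addr0// => t' /andP[_ t't].
  case: eqP => // ht'; move: t't; rewrite (h_inj t' t) ?eqxx//.
  by rewrite ht ht'.
under eq_bigr do rewrite FE.
rewrite exchange_big; apply: eq_bigr => t Dt /=.
have [I hE] := hI t Dt.
rewrite (bigD1 I)//= hE eqxx big1 ?addr0// => J JI.
case: eqP => // hJ; move/eqP: JI; case; apply/setP => j.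
by rewrite -(mem_enum I) -(mem_enum J) hE hJ.
Qed.

Lemma sum_sets1 F : (forall a, size a != 1%N -> F a = 0) ->
  \sum_(I : {set 'I_n}) F (enum I) = \sum_j F [:: j].
Proof.
move=> F1; apply: (sum_by_enum (h := fun j => [:: j]) (dom := xpredT)).
- move=> I; case E: (enum I) => [|j [|k a]];
    rewrite ?(F1 [::]) ?(F1 [:: _, _ & _]) ?eqxx//.
  by exists j.
- by move=> j _; exists (finset.set1 j); rewrite enum_set1.
- by move=> i j [].
Qed.

Lemma enum_set_sorted I : sorted (fun i j : 'I_n => i < j)%N (enum I).
Proof.
rewrite /enum_mem; apply: sorted_filter => [i j k|]; first exact: ltn_trans.
by have := iota_ltn_sorted 0 n; rewrite -val_enum_ord sorted_map enumT.
Qed.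

Lemma sum_sets2 F : (forall a, size a != 2%N -> F a = 0) ->
  \sum_(I : {set 'I_n}) F (enum I) =
  \sum_(i < n) \sum_(j < n) (if (i < j)%N then F [:: i; j] else 0).
Proof.
move=> F2.
rewrite pair_bigA /= -big_mkcond /=.
apply: (sum_by_enum (h := fun ij => [:: ij.1; ij.2])
  (dom := fun ij : 'I_n * 'I_n => (ij.1 < ij.2)%N)) => [I|[i j] /= ij|].
- have := enum_set_sorted I.
  case E: (enum I) => [|i [|j [|k a]]] /=;
    rewrite ?(F2 [::]) ?(F2 [:: _]) ?(F2 [:: _, _, _ & _]) ?eqxx//.
  by rewrite andbT => ij _; exists (i, j).
- exists [set k in [:: i; j]].
  apply: (@irr_sorted_eq _ (fun i j : 'I_n => i < j)%N).
  + by move=> a b c; exact: ltn_trans.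
  + by move=> a; exact: ltnn.
  + exact: enum_set_sorted.
  + by rewrite /= ij.
  + by move=> k; rewrite mem_enum !inE.
- by move=> [i j] [k l] [/= -> ->].
Qed.

End SetSums.

(** * Multivector fields on a manifold *)

Lemma col_sum_delta {R : realType} {n : nat} (a : 'cV[R]_n) :
  a = \sum_j a j 0 *: delta_mx j 0.
Proof.
rewrite {1}(matrix_sum_delta a); apply: eq_bigr => j _.
by rewrite big_ord1.
Qed.

Section Manifold.
Context {R : realType} {n : nat} {M : manifold R n}.
Local Notation e' j := (delta_mx j 0 : 'cV[R]_n).
Implicit Types (i j : chart M) (S T X Y P : multivector_field M) (f : M -> R).

Lemma codom_chart_open i : open (codom_chart i). Proof. exact: coord_open. Qed.
Arguments codom_chart_open i : clear implicits.

(** The overlap is the preimage of [dom j] under [param i], which is continuous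
    on the open set [codom_chart i]. *)
Lemma overlap_open i j : open (overlap i j).
Proof.
rewrite openE => x [p [pi pj] <-].
have Ux : codom_chart i (Defs.coord i p) by exists p.
have := @param_continuous _ _ M i.
rewrite continuous_open_subspace; last exact: coord_open.
move=> /(_ (Defs.coord i p)).
rewrite inE => /(_ Ux); rewrite /continuous_at coordK// => cp.
have nj : nbhs p (dom j) by apply: open_nbhs_nbhs; split=> //; exact: dom_open.
have nU : nbhs (Defs.coord i p) (codom_chart i).
  by apply: open_nbhs_nbhs; split=> //; exact: codom_chart_open.
apply: (@filterS2 _ _ (nbhs_filter _) _ _ _ _ (cp _ nj) nU) => y /= yj.
by move=> [q qi qy]; exists q => //; split=> //; rewrite -qy coordK in yj.
Qed.

Arguments overlap_open i j : clear implicits.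

Lemma transition_codom i j x :
  overlap i j x -> codom_chart j (transition i j x).
Proof.
by move=> [p [pi pj] <-]; exists p; rewrite // /transition /= coordK.
Qed.

Lemma param_transition i j x :
  overlap i j x -> param j (transition i j x) = param i x.
Proof. by move=> [p [pi pj] <-]; rewrite /transition /= coordK// coordK. Qed.

(** The chain rule for f o param i = (f o param j) o transition i j. *)
Lemma differential_transition f i j x : smooth_function f -> overlap i j x ->
  'J (transition i j) x *m differential f j (transition i j x) =
  differential f i x.
Proof.
move=> sf oij; have oji := transition_codom oij.
have dt : differentiable (transition i j) x.
  exact: (transition_smooth i j 1%N).1 oij.
have dj : differentiable (f \o param j) (transition i j x).
  exact: smooth_differentiable (sf j) oji.
apply/colP => k; rewrite !mxE.
have -> : 'D_(delta_mx 0 k) (f \o param i) x =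
          'D_(delta_mx 0 k) ((f \o param j) \o transition i j) x.
  have E : {in overlap i j,
      f \o param i =1 (f \o param j) \o transition i j}.
    by move=> y; rewrite inE => oy; rewrite /= param_transition.
  have ox : x \in overlap i j by rewrite inE.
  exact: (eq_on_derive (overlap_open i j) (delta_mx 0 k) E ox).
rewrite deriveE; last exact: differentiable_comp.
rewrite diff_comp//= [X in 'd _ _ X]row_sum_delta linear_sum.
apply: eq_bigr => l _; rewrite !mxE linearZ/= deriveE//.
Qed.

Lemma is_multivectorD k S T : is_multivector k S -> is_multivector k T ->
  is_multivector k (add_field S T).
Proof.
move=> [[S0 Sa Ss] St] [[T0 Ta Ts] Tt]; split; first split.
- by move=> i x s Ux sk; rewrite /add_field S0// T0// addr0.
- move=> i x Ux; have [Sl Sn] := Sa i x Ux; have [Tl Tn] := Ta i x Ux.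
  by split=> *; rewrite /add_field ?Sl ?Tl ?Sn ?Tn; ring.
- by move=> i s; apply: smoothD => //; exact: codom_chart_open.
- by move=> i j x s oij; rewrite /add_field St// Tt.
Qed.

Section VectorField.
Context {X : multivector_field M}.
Hypothesis XP : is_multivector 1 X.

Lemma vector_linear i x a u v : codom_chart i x ->
  X i x [:: a *: u + v] = a * X i x [:: u] + X i x [:: v].
Proof.
move=> Ux; have [[_ /(_ i x Ux)[Xl _] _] _] := XP.
exact: (Xl [::] [::]).
Qed.

Lemma vector_smooth i s : smooth_on (codom_chart i) (fun x => X i x s).
Proof. by have [[_ _]] := XP. Qed.

Lemma vector_expansion i x a : codom_chart i x ->
  X i x [:: a] = \sum_j a j 0 * X i x [:: e' j].
Proof.
move=> Ux; rewrite {1}(col_sum_delta a); have [[_ /(_ i x Ux) Xa _] _] := XP.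
rewrite (multilinear_sum Xa _ _ [::] [::]); apply: eq_bigr => j _.
exact: (multilinearZ Xa [::] [::]).
Qed.

Definition vector_coef i (j : 'I_n) :
    smooth_fun (OpenSet (codom_chart_open i)) :=
  SmoothFun (O := OpenSet (codom_chart_open i)) (vector_smooth i [:: e' j]).
End VectorField.

Lemma is_multivector_wedge X Y : is_multivector 1 X -> is_multivector 1 Y ->
  is_multivector 2 (wedge X Y).
Proof.
move=> XP YP; split; first split.
- by move=> i x [|a [|b [|c s]]].
- move=> i x Ux; split=> [s t a u v|s t r u]; last first.
    case: s t r => [|b [|c [|c' s]]] [|d [|d' t]] [|e r];
      by rewrite /wedge /= ?subrr.
  case: s t => [|b [|c [|c' s]]] [|d [|d' t]];
    rewrite /wedge /= ?(vector_linear XP _ _ _ Ux)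
      ?(vector_linear YP _ _ _ Ux); ring.
- move=> i [|a [|b [|c s]]] /=; try exact: smooth_cst.
  have oU := codom_chart_open i.
  have sX := vector_smooth XP i; have sY := vector_smooth YP i.
  have -> : (fun x => wedge X Y i x [:: a; b]) = (fun x =>
      X i x [:: a] * Y i x [:: b] + -1 * (X i x [:: b] * Y i x [:: a])).
    by apply/funext => x; rewrite /wedge mulN1r.
  apply: smoothD => //; first exact: smoothM.
  by apply: smoothM => //; [exact: smooth_cst|exact: smoothM].
- move=> i j x s oij; have [_ Xt] := XP; have [_ Yt] := YP.
  by case: s => [|a [|b [|c s]]] //=; rewrite /wedge !Xt// !Yt.
Qed.

Section Hamiltonian.
Context {P : multivector_field M} {f : M -> R}.
Hypothesis PP : is_multivector 2 P.
Hypothesis f_smooth : smooth_function f.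

Lemma bivector_expansion i x a b : codom_chart i x ->
  P i x [:: a; b] = \sum_j a j 0 * P i x [:: e' j; b].
Proof.
move=> Ux; rewrite {1}(col_sum_delta a); have [[_ /(_ i x Ux) Pa _] _] := PP.
rewrite (multilinear_sum Pa _ _ [::] [:: b]); apply: eq_bigr => j _.
exact: (multilinearZ Pa [::] [:: b]).
Qed.

Lemma bivector_swap i x a b : codom_chart i x ->
  P i x [:: a; b] = - P i x [:: b; a].
Proof.
move=> Ux; have [[_ /(_ i x Ux) Pa _] _] := PP.
exact: (alternating_swap Pa [::] [::]).
Qed.

Lemma is_multivector_hamiltonian : is_multivector 1 (hamiltonian P f).
Proof.
have [[P0 Pa Ps] Pt] := PP; split; first split.
- by move=> i x [|a [|b s]].
- move=> i x Ux; split=> [s t a u v|s t r u]; last first.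
    by case: s t => [|b [|c s]] [|d t].
  have [Pl _] := Pa i x Ux.
  case: s t => [|b [|c s]] [|d t]; rewrite /hamiltonian /= ?mulr0 ?addr0//.
  by rewrite (Pl [:: _] [::]) /=; ring.
- move=> i [|a [|b s]] /=; try exact: smooth_cst.
  have oU := codom_chart_open i.
  apply: (@eq_smooth _ _ _ oU (fun x => -1 * \sum_j
    'D_(delta_mx 0 j) (f \o param i) x * P i x [:: e' j; a])).
    move=> x; rewrite inE => Ux; rewrite mulN1r bivector_expansion//.
    by congr (- _); apply: eq_bigr => j _; rewrite mxE.
  apply: smoothM => //; first exact: smooth_cst.
  apply: smooth_sum => // j; apply: smoothM => //.
  exact/smooth_derive/f_smooth.
- move=> i j x [|a [|b s]] oij //=; rewrite /hamiltonian Pt//=.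
  by rewrite differential_transition.
Qed.
End Hamiltonian.

End Manifold.

Arguments codom_chart_open {R n M} i.

(** * Local expressions of the operators *)

Section LocalExpressions.
Context {R : realType} {n : nat} {M : manifold R n} (i : chart M).
Local Notation O := (OpenSet (codom_chart_open i)).
Local Notation U := (codom_chart i).
Local Notation lform := (form O).
Local Notation e_ j := (delta_mx 0 j : 'rV[R]_n).
Local Notation e' j := (delta_mx j 0 : 'cV[R]_n).
Implicit Types (rho : form_field M) (r : lform) (P Q X Y : multivector_field M).

(** [represents] transports the algebra of operators on [form] to the operators
    on fields, which act on the local expressions of all charts at once and are
    only meaningful on the codomains of the charts. *)
Definition agree rho r : Prop := forall x, U x -> forall s, rho i x s = r x s.

Definition represents (A : form_field M -> form_field M)
    (A' : lform -> lform) : Prop :=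
  forall rho r, agree rho r -> agree (A rho) (A' r).

Lemma form_agree k rho : is_form k rho ->
  exists2 r, agree rho r & forall x s, size s != k -> r x s = 0.
Proof.
move=> [[rho0 alt sm] _]; have alti x := alt i x.
exists (restriction (O := O) alti (sm i)) => [x Ux s|x s sk].
  by rewrite restrictionE.
have [Ux|nUx] := pselect (U x); last exact: form_out.
by rewrite restrictionE// rho0.
Qed.

Lemma agree_eq rho r t : agree rho r -> agree rho t -> r = t.
Proof. by move=> rr rt; apply: form_eq => x s Ux; rewrite -rr// rt. Qed.

Lemma represents_ext_d : represents (@ext_d R n M) (@extd R n O).
Proof.
move=> rho r rr x Ux s; rewrite extdE// /ext_d /ext_raw.
apply: eq_bigr => l _; congr (_ * _).
have E : {in U, rho i ^~ (take l s ++ drop l.+1 s) =1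
                r ^~ (take l s ++ drop l.+1 s)}.
  by move=> y; rewrite inE => Uy; exact: rr.
have Ux' : x \in U by rewrite inE.
exact: (eq_on_derive (codom_chart_open i) s`_l E Ux').
Qed.

Lemma represents_gcomm a b A B A' B' : represents A A' -> represents B B' ->
  represents (gcomm a b A B)
    (fun r => A' (B' r) - (-1) ^+ (a * b) *: B' (A' r)).
Proof.
move=> AA BB rho r rr x Ux s; rewrite formD formN formZ /gcomm.
by rewrite (AA _ _ (BB _ _ rr))// (BB _ _ (AA _ _ rr)).
Qed.

Lemma represents_Lie A A' : represents A A' ->
  represents (gcomm 2 1 A (@ext_d R n M)) (fun r => A' (extd r) - extd (A' r)).
Proof.
move=> AA rho r rr x Ux s.
rewrite (represents_gcomm 2 1 AA represents_ext_d rr Ux).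
by rewrite -signr_odd expr0 scale1r.
Qed.

Lemma represents_bracket2 A B A' B' : represents A A' -> represents B B' ->
  represents (gcomm 3 2 A B) (fun r => A' (B' r) - B' (A' r)).
Proof.
move=> AA BB rho r rr x Ux s; rewrite (represents_gcomm 3 2 AA BB rr Ux).
by rewrite -signr_odd expr0 scale1r.
Qed.

Lemma represents_bracket1 A B A' B' : represents A A' -> represents B B' ->
  represents (gcomm 3 1 A B) (fun r => A' (B' r) + B' (A' r)).
Proof.
move=> AA BB rho r rr x Ux s; rewrite (represents_gcomm 3 1 AA BB rr Ux).
by rewrite -signr_odd expr1 scaleN1r opprK.
Qed.

Lemma insertion_zero rho x s : insertion (@zero_field R n M _) rho i x s = 0.
Proof. by rewrite /insertion big1// => I _; rewrite mul0r. Qed.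

Lemma insertion_vector X rho x s : (forall a, size a != 1%N -> X i x a = 0) ->
  insertion X rho i x s = \sum_j X i x [:: e' j] * rho i x (e_ j :: s).
Proof.
move=> X0; rewrite /insertion.
rewrite (@sum_sets1 _ _ (fun a => X i x [seq e' j | j <- a] *
  rho i x (rev [seq e_ j | j <- a] ++ s)))//.
by move=> a a1; rewrite X0 ?mul0r// size_map.
Qed.

Lemma insertion_bivector Q rho x s : (forall a, size a != 2%N -> Q i x a = 0) ->
  insertion Q rho i x s = \sum_(j < n) \sum_(k < n)
    (if (j < k)%N then Q i x [:: e' j; e' k] * rho i x [:: e_ k, e_ j & s]
     else 0).
Proof.
move=> Q0; rewrite /insertion.
rewrite (@sum_sets2 _ _ (fun a => Q i x [seq e' j | j <- a] *
  rho i x (rev [seq e_ j | j <- a] ++ s)))//.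
by move=> a a2; rewrite Q0 ?mul0r// size_map.
Qed.

Lemma insertion_add P Q rho x s :
  insertion (add_field P Q) rho i x s =
  insertion P rho i x s + insertion Q rho i x s.
Proof.
rewrite /insertion -big_split; apply: eq_bigr => I _ /=.
by rewrite /add_field mulrDl.
Qed.

Lemma insertion_mul f X rho x s :
  insertion (mul_field f X) rho i x s = f (param i x) * insertion X rho i x s.
Proof.
by rewrite /insertion mulr_sumr; apply: eq_bigr => I _; rewrite mulrA.
Qed.

Lemma represents_vector X (XP : is_multivector 1 X) :
  represents (insertion X) (insv (vector_coef XP i)).
Proof.
move=> rho r rr x Ux s; have [[X0 _ _] _] := XP.
rewrite insertion_vector; last by move=> a; exact: X0.
rewrite /insv form_sum; apply: eq_bigr => j _.
by rewrite mulfE iotaE rr.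
Qed.

Section Bivector.
Context {P : multivector_field M}.
Hypothesis PP : is_multivector 2 P.

Lemma bivector_coef_smooth (j k : 'I_n) : smooth_on U
  (fun x => if (j < k)%N then P i x [:: e' j; e' k] else 0).
Proof.
case: (j < k)%N; last exact: smooth_cst.
by have [[_ _]] := PP.
Qed.

Definition bivector_coef (j k : 'I_n) : smooth_fun O :=
  SmoothFun (O := O) (bivector_coef_smooth j k).

Lemma represents_bivector : represents (insertion P) (insb bivector_coef).
Proof.
move=> rho r rr x Ux s; have [[P0 _ _] _] := PP.
rewrite insertion_bivector; last by move=> a; exact: P0.
rewrite /insb form_sum; apply: eq_bigr => j _.
rewrite form_sum; apply: eq_bigr => k _.
by rewrite mulfE !iotaE /=; case: ifP => _; rewrite ?mul0r// rr.
Qed.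

(** Only the first-order part of L_P contributes to its commutator with a
    function: this is the identity [[P, f]] = P_f. *)
Lemma hamiltonian_commutator f (sf : smooth_function f)
    (nu := SmoothFun (O := O) (sf i)) r :
  insv (vector_coef (is_multivector_hamiltonian PP sf) i) r =
  lieb bivector_coef (mulf nu r) - mulf nu (lieb bivector_coef r).
Proof.
rewrite lieb_mulf; apply: form_eq => x s Ux.
pose nu_ j := 'D_(e_ j) (f \o param i) x.
transitivity (\sum_(j < n) \sum_(k < n)
    (nu_ k * r x (e_ j :: s)) * P i x [:: e' j; e' k]).
  rewrite /insv form_sum; apply: eq_bigr => j _; rewrite mulfE iotaE /=.
  rewrite (bivector_expansion PP)// -sumrN mulr_suml; apply: eq_bigr => k _.
  by rewrite mxE (bivector_swap PP _ (e' k))//; rewrite /nu_; ring.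
have PN j k : P i x [:: e' j; e' k] = - P i x [:: e' k; e' j].
  exact: (bivector_swap PP).
have P0 j : P i x [:: e' j; e' j] = 0.
  have [[_ /(_ i x Ux)[_ /(_ [::] [::] [::])+] _] _] := PP; exact.
rewrite -(sum_antisym _ PN P0) form_sum; apply: eq_bigr => j _.
rewrite form_sum; apply: eq_bigr => k _.
rewrite !(formD, formN, mulfE, iotaE) /= -/(nu_ j) -/(nu_ k).
by case: ifP => _; ring.
Qed.
End Bivector.

Lemma represents_wedge X Y (XP : is_multivector 1 X) (YP : is_multivector 1 Y) :
  represents (insertion (wedge X Y))
    (insq (X := vector_coef XP i) (Y := vector_coef YP i)).
Proof.
move=> rho r rr x Ux s.
rewrite insertion_bivector; last by move=> [|a [|b [|c l]]].
rewrite /insq insv_insv form_sum.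
transitivity (\sum_(j < n) \sum_(k < n)
    (X i x [:: e' j] * Y i x [:: e' k]) * r x [:: e_ k, e_ j & s]).
  rewrite -sum_antisym; first last.
  - by move=> j; have [_ /(_ [::] [::])] := form_alternating r x; exact.
  - by move=> j k; exact: (alternating_swap (form_alternating r x) [::]).
  apply: eq_bigr => j _; apply: eq_bigr => k _; case: ifP => _ //.
  by rewrite rr// /wedge; congr (_ * _); ring.
apply: eq_bigr => j _; rewrite form_sum; apply: eq_bigr => k _.
by rewrite !mulfE !iotaE /= mulrA.
Qed.

End LocalExpressions.

(** * Perturbation of a Poisson bivector by its modular vector field *)

Section Perturbation.
Context {R : realType} {n : nat} {M : manifold R n}.
Context {omega : form_field M} {P Xi : multivector_field M} {nu : M -> R}.
Hypothesis omega_volume : is_volume_form omega.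
Hypothesis P_poisson : is_poisson P.
Hypothesis Xi_modular : is_modular omega P Xi.
Hypothesis nu_smooth : smooth_function nu.
Hypothesis Xi_nu : forall i x, codom_chart i x -> apply_vector Xi nu i x = 1.

Let PP : is_multivector 2 P := P_poisson.1.
Let XP : is_multivector 1 Xi := Xi_modular.1.
Let YP : is_multivector 1 (hamiltonian P nu) :=
  is_multivector_hamiltonian PP nu_smooth.
Let Q := wedge Xi (hamiltonian P nu).
Let QP : is_multivector 2 Q := is_multivector_wedge XP YP.

Section Chart.
Variable i : chart M.
Local Notation O := (OpenSet (codom_chart_open i)).
Let p := bivector_coef i PP.
Let X := vector_coef XP i.
Let Y := vector_coef YP i.
Let nu' : smooth_fun O := SmoothFun (O := O) (nu_smooth i).

Lemma chart_volume : exists w : form O, [/\ agree omega w,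
  forall x s, size s != n -> w x s = 0 &
  forall x, open_carrier O x -> exists s, w x s != 0].
Proof.
have [omega_form omega_neq0] := omega_volume.
have [w ww w0] := form_agree i omega_form.
exists w; split=> // x Ux; have [s ws] := omega_neq0 i x Ux.
by exists s; rewrite -ww.
Qed.

Lemma chart_jacobi (w : form O) : agree omega w ->
  lieb p (insb p w) - insb p (lieb p w) = 0.
Proof.
move=> ww; have [_ [_ /(_ n omega omega_volume.1) Pw]] := P_poisson.
have rP := represents_bivector (i := i) PP.
have := represents_bracket2 (represents_Lie rP) rP ww.
move=> Pww; apply: form_eq => x s Ux; rewrite form0.
have := Pw i x Ux s; rewrite Pww// => <-.
by rewrite insertion_zero.
Qed.

Lemma chart_modular (w : form O) : agree omega w ->
  insv X w = extd (insb p w).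
Proof.
move=> ww; apply: form_eq => x s Ux; have [_ Xw] := Xi_modular.
rewrite -(represents_vector XP ww Ux) Xw//.
exact: (represents_ext_d (represents_bivector PP ww)).
Qed.

Lemma chart_nu r :
  \sum_j mulf (X j) (mulf (sfun_derive nu' (delta_mx 0 j)) r) = r.
Proof.
apply: form_eq => x s Ux; rewrite form_sum -[RHS]mul1r -(Xi_nu Ux).
rewrite /apply_vector (vector_expansion XP)// mulr_suml.
by apply: eq_bigr => j _; rewrite !mulfE mxE /=; ring.
Qed.

Lemma chart_hamiltonian r :
  insv Y r = lieb p (mulf nu' r) - mulf nu' (lieb p r).
Proof. exact: hamiltonian_commutator. Qed.

Lemma chart_combination_jacobi a (T := insc (p := p) (X := X) (Y := Y) a) r :
  T (extd (T r)) - extd (T (T r)) - T (T (extd r) - extd (T r)) = 0.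
Proof.
have [w [ww w_top w_neq0]] := chart_volume.
exact: (liec_insc w_top w_neq0 (chart_jacobi ww) (chart_modular ww)
  chart_nu chart_hamiltonian a r).
Qed.

Lemma chart_combination_unimodular (T := insc (p := p) (X := X) (Y := Y) 1)
    (w : form O) : agree omega w -> T (extd w) - extd (T w) = 0.
Proof.
move=> ww; have [w' [ww' w_top w_neq0]] := chart_volume.
rewrite -(agree_eq ww ww') in w_top w_neq0.
apply: (etrans (liecE 1 w)); rewrite scale1r.
rewrite (lieq_w w_top w_neq0 (chart_jacobi ww) (chart_modular ww)
  chart_nu chart_hamiltonian).
by rewrite subrr.
Qed.

Lemma chart_lieq (w : form O) : agree omega w ->
  lieq (X := X) (Y := Y) w = - lieb p w.
Proof.
move=> ww; have [w' [ww' w_top w_neq0]] := chart_volume.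
rewrite -(agree_eq ww ww') in w_top w_neq0.
exact: (lieq_w w_top w_neq0 (chart_jacobi ww) (chart_modular ww)
  chart_nu chart_hamiltonian).
Qed.

Lemma chart_mul_insv r :
  lieb p (mulf nu' (insv X r)) + mulf nu' (insv X (lieb p r)) =
  insv Y (insv X r).
Proof.
have [w [ww w_top w_neq0]] := chart_volume.
exact: (lieb_mul_insv w_top w_neq0 (chart_jacobi ww) (chart_modular ww)
  chart_hamiltonian r).
Qed.

End Chart.

Lemma poisson_of_jacobi (T : multivector_field M)
    (T' : forall i, form (OpenSet (codom_chart_open i)) ->
                    form (OpenSet (codom_chart_open i))) :
  is_multivector 2 T -> (forall i, represents (insertion T) (T' i)) ->
  (forall i r, T' i (extd (T' i r)) - extd (T' i (T' i r)) -
               T' i (T' i (extd r) - extd (T' i r)) = 0) ->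
  is_poisson T.
Proof.
move=> TP rT T0; split=> //; split; first exact: P_poisson.2.1.
move=> k rho rho_form i x Ux s; have [r rr _] := form_agree i rho_form.
rewrite insertion_zero.
by rewrite (represents_bracket2 (represents_Lie (rT i)) (rT i) rr)// T0.
Qed.

(** The insertion operators of Q, P + Q, Q + P and P + Q + P are all of the form
    a i_P + i_Q with a constant a, so that one computation covers them all. *)
Lemma combination_poisson a T : is_multivector 2 T ->
  (forall rho i x s, insertion T rho i x s =
    a * insertion P rho i x s + insertion Q rho i x s) ->
  is_poisson T.
Proof.
move=> TP TE; apply: (poisson_of_jacobi TP
  (T' := fun i => insc (p := bivector_coef i PP) (X := vector_coef XP i)
                       (Y := vector_coef YP i) a)); last first.
  by move=> i r; exact: chart_combination_jacobi.
move=> i rho r rr x Ux s; rewrite TE /insc formD formZ.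
by rewrite (represents_bivector PP rr)// (represents_wedge XP YP rr).
Qed.

Lemma wedge_poisson : is_poisson Q.
Proof. by apply: (@combination_poisson 0) => // *; rewrite mul0r add0r. Qed.

Lemma addPQ_poisson : is_poisson (add_field P Q).
Proof.
apply: (@combination_poisson 1) => [|*]; first exact: is_multivectorD.
by rewrite insertion_add mul1r.
Qed.

Lemma addQP_poisson : is_poisson (add_field Q P).
Proof.
apply: (@combination_poisson 1) => [|*]; first exact: is_multivectorD.
by rewrite insertion_add mul1r addrC.
Qed.

Lemma addPQP_poisson : is_poisson (add_field (add_field P Q) P).
Proof.
apply: (@combination_poisson 2) => [|*].
  by apply: is_multivectorD => //; exact: is_multivectorD.
by rewrite !insertion_add; ring.
Qed.

Lemma Lie_wedge : eq_field (Lie 2 Q omega) (opp_field (Lie 2 P omega)).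
Proof.
move=> i x Ux s; have [w [ww _ _]] := chart_volume i.
rewrite /opp_field /Lie (represents_Lie (represents_bivector PP) ww)//.
rewrite (represents_Lie (represents_wedge XP YP) ww)//.
exact: (congr1 (fun r : form _ => r x s) (chart_lieq ww)).
Qed.

Lemma addPQ_unimodular : unimodular omega (add_field P Q).
Proof.
move=> i x Ux s; have [w [ww _ _]] := chart_volume i.
have rT : represents (i := i) (insertion (add_field P Q))
    (insc (p := bivector_coef i PP) (X := vector_coef XP i)
          (Y := vector_coef YP i) 1).
  move=> rho r rr y Uy q; rewrite insertion_add /insc formD formZ mul1r.
  by rewrite (represents_bivector PP rr)// (represents_wedge XP YP rr).
by rewrite /Lie (represents_Lie rT ww)// chart_combination_unimodular.
Qed.

Lemma addPQ_casimir : is_casimir (add_field P Q) nu.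
Proof.
split=> // i x Ux a; rewrite /add_field /Q /wedge /hamiltonian.
have := Xi_nu Ux; rewrite /apply_vector => ->.
have -> : P i x [:: differential nu i x; differential nu i x] = 0.
  have [[_ /(_ i x Ux)[_ /(_ [::] [::] [::])+] _] _] := PP; exact.
by ring.
Qed.

Lemma schouten_mul_modular :
  is_schouten 2 1 P (mul_field nu Xi) (wedge (hamiltonian P nu) Xi).
Proof.
split; first exact: is_multivector_wedge.
move=> k rho rho_form i x Ux s; have [r rr _] := form_agree i rho_form.
pose nu' : smooth_fun (OpenSet (codom_chart_open i)) :=
  SmoothFun (O := OpenSet (codom_chart_open i)) (nu_smooth i).
have rX : represents (i := i) (insertion (mul_field nu Xi))
    (fun r => mulf nu' (insv (vector_coef XP i) r)).
  move=> sg t st y Uy q; rewrite insertion_mul mulfE.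
  by rewrite (represents_vector XP st).
have rL := represents_Lie (represents_bivector (i := i) PP).
rewrite (represents_bracket1 rL rX rr)// (represents_wedge YP XP rr)//.
exact: (congr1 (fun t : form _ => t x s) (esym (chart_mul_insv r))).
Qed.

End Perturbation.

Theorem proposition3p8 (R : realType) (n : nat) (M : manifold R n)
    (omega : form_field M) (P Xi : multivector_field M) (nu : M -> R)
    (omega_volume : is_volume_form omega)
    (P_poisson : is_poisson P)
    (Xi_modular : is_modular omega P Xi)
    (nu_smooth : smooth_function nu)
    (Xi_nu : forall i x, codom_chart i x -> apply_vector Xi nu i x = 1) :
  let Pnu := hamiltonian P nu in
  let Q := wedge Xi Pnu in
  [/\ is_poisson Q /\ compatible Q P,
      eq_field (Lie 2 Q omega) (opp_field (Lie 2 P omega)),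
      [/\ is_poisson (add_field P Q), unimodular omega (add_field P Q),
          compatible (add_field P Q) P & is_casimir (add_field P Q) nu] &
      is_schouten 2 1 P (mul_field nu Xi) (wedge Pnu Xi) /\
      is_partial P 1 (mul_field nu Xi) (wedge Pnu Xi)].
Proof.
move=> Pnu Q.
have Q_poisson : is_poisson Q.
  exact: (wedge_poisson omega_volume P_poisson Xi_modular nu_smooth Xi_nu).
have PQ_poisson : is_poisson (add_field P Q).
  exact: (addPQ_poisson omega_volume P_poisson Xi_modular nu_smooth Xi_nu).
have PnuXi : is_schouten 2 1 P (mul_field nu Xi) (wedge Pnu Xi).
  exact: (schouten_mul_modular omega_volume P_poisson Xi_modular nu_smooth).
have QP_poisson : is_poisson (add_field Q P).
  exact: (addQP_poisson omega_volume P_poisson Xi_modular nu_smooth Xi_nu).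
have PQP_poisson : is_poisson (add_field (add_field P Q) P).
  exact: (addPQP_poisson omega_volume P_poisson Xi_modular nu_smooth Xi_nu).
have L_Q := Lie_wedge omega_volume P_poisson Xi_modular nu_smooth Xi_nu.
have PQ_unimodular :=
  addPQ_unimodular omega_volume P_poisson Xi_modular nu_smooth Xi_nu.
have PQ_casimir := addPQ_casimir P_poisson nu_smooth Xi_nu.
exact: (And4 (conj Q_poisson (And3 Q_poisson P_poisson QP_poisson)) L_Q
  (And4 PQ_poisson PQ_unimodular (And3 PQ_poisson P_poisson PQP_poisson)
    PQ_casimir)
  (conj PnuXi PnuXi)).
Qed.
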